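(* Let $\Bbbk$ be a field and let $p,q\in\Bbbk$ be arbitrary scalars (possibly zero). Let $\mathbf{h}$ be a connected $p$-Hopf monoid, and let $\mathbf{k}$ be a $q$-Hopf monoid that is free as a monoid. Then the Hadamard product $\mathbf{h}\times\mathbf{k}$ is a connected $pq$-Hopf monoid that is free as a monoid.
   Context: **Species.** Fix a field $\Bbbk$. A species is a functor from the category of finite sets and bijections to the category of $\Bbbk$-vector spaces; a morphism of species is a natural transformation. The value of a species $\mathbf{p}$ on a finite set $I$ is $\mathbf{p}[I]$. The notation $I=S\sqcup T$ means $I=S\cup T$ and $S\cap T=\emptyset$ (ordered pair $(S,T)$, parts possibly empty). A species $\mathbf{p}$ is connected if $\dim_\Bbbk\mathbf{p}[\emptyset]=1$, and positive if $\mathbf{p}[\emptyset]=0$. **Monoids and comonoids.** A monoid (in species) is a species $\mathbf{p}$ with linear maps $\mu_{S,T}:\mathbf{p}[S]\otimes\mathbf{p}[T]\to\mathbf{p}[I]$, one for each $I=S\sqcup T$, natural with respect to bijections of $I$, and a linear map $\iota_\emptyset:\Bbbk\to\mathbf{p}[\emptyset]$, which are associative ($\mu_{R\sqcup S,T}(\mu_{R,S}\otimes\mathrm{id})=\mu_{R,S\sqcup T}(\mathrm{id}\otimes\mu_{S,T})$) and unital ($\mu_{\emptyset,I}(\iota_\emptyset\otimes\mathrm{id})=\mathrm{id}=\mu_{I,\emptyset}(\mathrm{id}\otimes\iota_\emptyset)$). Morphisms of monoids are morphisms of species commuting with products and units. Dually, a comonoid has natural maps $\Delta_{S,T}:\mathbf{p}[I]\to\mathbf{p}[S]\otimes\mathbf{p}[T]$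 and $\epsilon_\emptyset:\mathbf{p}[\emptyset]\to\Bbbk$, coassociative and counital. **$q$-bimonoids and $q$-Hopf monoids.** For $q\in\Bbbk$, a $q$-bimonoid is a species $\mathbf{h}$ which is a monoid and a comonoid such that (i) for any $I=S\sqcup T=S'\sqcup T'$, with $A=S\cap S'$, $B=S\cap T'$, $C=T\cap S'$, $D=T\cap T'$, $$\Delta_{S',T'}\,\mu_{S,T}=(\mu_{A,C}\otimes\mu_{B,D})(\mathrm{id}\otimes\beta_q\otimes\mathrm{id})(\Delta_{A,B}\otimes\Delta_{C,D}),$$ where $\beta_q:\mathbf{h}[B]\otimes\mathbf{h}[C]\to\mathbf{h}[C]\otimes\mathbf{h}[B]$ is $x\otimes y\mapsto q^{|B||C|}\,y\otimes x$ (with $0^0=1$); and (ii) the unit/counit compatibilities hold: $\epsilon_\emptyset\iota_\emptyset=\mathrm{id}$, $\epsilon_\emptyset\mu_{\emptyset,\emptyset}=\epsilon_\emptyset\otimes\epsilon_\emptyset$, $\Delta_{\emptyset,\emptyset}\iota_\emptyset=\iota_\emptyset\otimes\iota_\emptyset$. A $q$-Hopf monoid is a $q$-bimonoid with an antipode, i.e. a morphism of species $s:\mathbf{h}\to\mathbf{h}$ such that for every $I$ both $\sum_{I=S\sqcup T}\mu_{S,T}(\mathrm{id}\otimes s_T)\Delta_{S,T}$ and $\sum_{I=S\sqcup T}\mu_{S,T}(s_S\otimes\mathrm{id})\Delta_{S,T}$ equal $\iota_\emptyset\epsilon_\emptyset$ if $I=\emptyset$ and $0$ if $I\ne\emptyset$.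 (A connected $q$-bimonoid is automatically a $q$-Hopf monoid.) **Free monoids.** A composition $F=(I_1,\dots,I_k)$ of a finite set $I$ (written $F\vDash I$) is an ordered sequence of disjoint nonempty subsets with union $I$; the empty set has exactly one composition, with no blocks. For a positive species $\mathbf{q}$, put $\mathbf{q}(F)=\mathbf{q}[I_1]\otimes\cdots\otimes\mathbf{q}[I_k]$ ($=\Bbbk$ for the empty composition) and $\mathcal{T}(\mathbf{q})[I]=\bigoplus_{F\vDash I}\mathbf{q}(F)$, with bijections acting in the evident way. It is a monoid, with product the sum of the canonical isomorphisms $\mathbf{q}(F)\otimes\mathbf{q}(G)\cong\mathbf{q}(F\cdot G)$, $F\vDash S$, $G\vDash T$, where $F\cdot G$ is concatenation. A monoid is free if it is isomorphic, as a monoid, to $\mathcal{T}(\mathbf{q})$ for some positive species $\mathbf{q}$. **Hadamard product.** $(\mathbf{p}\times\mathbf{q})[I]=\mathbf{p}[I]\otimes\mathbf{q}[I]$, and similarly on bijections. If $\mathbf{h}$ is a $p$-bimonoid and $\mathbf{k}$ is a $q$-bimonoid, the product of $\mathbf{h}\times\mathbf{k}$ is $(\mathbf{h}[S]\otimes\mathbf{k}[S])\otimes(\mathbf{h}[T]\otimes\mathbf{k}[T])\cong(\mathbf{h}[S]\otimes\mathbf{h}[T])\otimes(\mathbf{k}[S]\otimes\mathbf{k}[T])\xrightarrow{\mu_{S,T}\otimes\mu_{S,T}}\mathbf{h}[I]\otimes\mathbf{k}[I]$, where the first map switches the middle tensor factors (without any power of $p$ or $q$); the coproduct, unit and counit are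 defined similarly. *)

(* Defs.v *)
From HB Require Import structures.
From mathcomp Require Import all_boot all_order all_algebra.
From mathcomp Require Import generic_quotient sesquilinear boolp.

Set Implicit Arguments.
Unset Strict Implicit.
Unset Printing Implicit Defensive.

Import GRing.Theory.
Local Open Scope ring_scope.
Local Open Scope quotient_scope.

Section LinearMaps.
Variables (K : fieldType) (V W : lmodType K).

(* Locked, so that simplification does not unfold the maps built with it. *)
Fact mklin_key : unit. Proof. exact: tt. Qed.

Definition mklin (f : V -> W) (hf : linear f) : {linear V -> W} :=
  let: tt := mklin_key in HB.pack f (GRing.isLinear.Build K V W *:%R f hf).

Lemma mklinE (f : V -> W) (hf : linear f) : mklin hf =1 f.
Proof. by rewrite /mklin; case: mklin_key. Qed.

End LinearMaps.

Notation bilin := (bilinear_for *:%R *:%R).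

(* MathComp has no tensor product of possibly infinite-dimensional spaces.
   An element of V (x) W is represented by a finite formal sum of pairs (v, w);
   two formal sums are identified when no bilinear map distinguishes them.
   The universal property is given by tlift, tliftE and tensor_ext. *)
Section TensorDef.
Variables (K : fieldType) (V W : lmodType K).
Implicit Types (s t : seq (V * W)) (U : lmodType K).

Definition bisum U (b : V -> W -> U) s : U := \sum_(x <- s) b x.1 x.2.

Definition teqv s t : bool :=
  `[< forall (U : lmodType K) (b : V -> W -> U), bilin b ->
        bisum b s = bisum b t >].

Lemma teqvP s t :
  reflect (forall (U : lmodType K) (b : V -> W -> U), bilin b ->
             bisum b s = bisum b t) (teqv s t).
Proof. exact: asboolP. Qed.

Fact teqv_equiv : equiv_class_of teqv.
Proof.
split=> [s|s t|t s u].
- exact/teqvP.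
- by apply/idP/idP=> /teqvP h; apply/teqvP=> U b hb; rewrite h.
- by move=> /teqvP h1 /teqvP h2; apply/teqvP=> U b hb; rewrite h1 ?h2.
Qed.

Canonical teqv_equivRel := EquivRelPack teqv_equiv.

Definition tensor := {eq_quot teqv}.

HB.instance Definition _ := Choice.on tensor.
HB.instance Definition _ := Quotient.on tensor.

Definition tens (v : V) (w : W) : tensor := \pi_tensor [:: (v, w)].

Definition tlift_fun U (b : V -> W -> U) (t : tensor) : U := bisum b (repr t).

Lemma tlift_funE U (b : V -> W -> U) (hb : bilin b) s :
  tlift_fun b (\pi_tensor s) = bisum b s.
Proof.
have /eqmodP : repr (\pi_tensor s) = s %[mod tensor] by rewrite reprK.
by move/teqvP=> /(_ U b hb).
Qed.

Lemma tensor_eqP (x y : tensor) :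
  (forall (U : lmodType K) (b : V -> W -> U), bilin b ->
     tlift_fun b x = tlift_fun b y) -> x = y.
Proof.
move=> h; rewrite -[x]reprK -[y]reprK; apply/eqmodP/teqvP=> U b hb.
exact: h.
Qed.

Definition tadd (x y : tensor) : tensor := \pi_tensor (repr x ++ repr y).
Definition tzero : tensor := \pi_tensor [::].
Definition tscale (a : K) (x : tensor) : tensor :=
  \pi_tensor [seq (a *: u.1, u.2) | u <- repr x].
Definition topp (x : tensor) : tensor := tscale (-1) x.

Section Lift.
Variables (U : lmodType K) (b : V -> W -> U).
Hypothesis hb : bilin b.

Lemma tlift0 : tlift_fun b tzero = 0.
Proof. by rewrite tlift_funE // /bisum big_nil. Qed.

Lemma tliftD x y : tlift_fun b (tadd x y) = tlift_fun b x + tlift_fun b y.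
Proof. by rewrite tlift_funE // /bisum big_cat. Qed.

Lemma tliftZ a x : tlift_fun b (tscale a x) = a *: tlift_fun b x.
Proof.
rewrite tlift_funE // /bisum big_map scaler_sumr; apply: eq_bigr => u _ /=.
exact: (scalable_linear (hb.1 u.2)).
Qed.

Lemma tliftN x : tlift_fun b (topp x) = - tlift_fun b x.
Proof. by rewrite tliftZ scaleN1r. Qed.
End Lift.

Let tE := (tliftD, tliftZ, tliftN, tlift0).

Fact taddA : associative tadd.
Proof. by move=> x y z; apply: tensor_eqP => U b hb; rewrite !tE // addrA. Qed.
Fact taddC : commutative tadd.
Proof. by move=> x y; apply: tensor_eqP => U b hb; rewrite !tE // addrC. Qed.
Fact tadd0 : left_id tzero tadd.
Proof. by move=> x; apply: tensor_eqP => U b hb; rewrite !tE // add0r. Qed.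
Fact taddN : left_inverse tzero topp tadd.
Proof. by move=> x; apply: tensor_eqP => U b hb; rewrite !tE // addNr. Qed.

HB.instance Definition _ :=
  GRing.isZmodule.Build tensor taddA taddC tadd0 taddN.

Fact tscaleA a c x : tscale a (tscale c x) = tscale (a * c) x.
Proof. by apply: tensor_eqP => U b hb; rewrite !tE // scalerA. Qed.
Fact tscale1 : left_id 1 tscale.
Proof. by move=> x; apply: tensor_eqP => U b hb; rewrite !tE // scale1r. Qed.
Fact tscaleDr : right_distributive tscale tadd.
Proof. by move=> a x y; apply: tensor_eqP => U b hb; rewrite !tE // scalerDr. Qed.
Fact tscaleDl x : {morph tscale^~ x : a c / a + c >-> tadd a c}.
Proof. by move=> a c; apply: tensor_eqP => U b hb; rewrite !tE // scalerDl. Qed.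

HB.instance Definition _ :=
  GRing.Zmodule_isLmodule.Build K tensor tscaleA tscale1 tscaleDr tscaleDl.

Fact tlift_linear U (b : V -> W -> U) (hb : bilin b) : linear (tlift_fun b).
Proof. by move=> a x y; rewrite [LHS]tliftD // [X in X + _]tliftZ. Qed.

Definition tlift U (b : V -> W -> U) (hb : bilin b) : {linear tensor -> U} :=
  mklin (tlift_linear hb).

Lemma tliftE U (b : V -> W -> U) (hb : bilin b) v w :
  tlift hb (tens v w) = b v w.
Proof. by rewrite mklinE tlift_funE // /bisum big_seq1. Qed.

Fact tens_bilin : bilin tens.
Proof.
split=> [w a v v'|v a w w']; apply: tensor_eqP => U b hb;
  rewrite [RHS]tliftD // [X in _ = X + _]tliftZ // !tlift_funE // /bisum;
  rewrite !big_seq1 /=; first by rewrite hb.1.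
by rewrite hb.2.
Qed.

Lemma tensor_sum (t : tensor) : t = \sum_(x <- repr t) tens x.1 x.2.
Proof.
apply: tensor_eqP => U b hb; rewrite -[RHS](mklinE (tlift_linear hb)).
by rewrite linear_sum; apply: eq_bigr => x _; rewrite tliftE.
Qed.

Lemma tensor_ext U (f g : {linear tensor -> U}) :
  (forall v w, f (tens v w) = g (tens v w)) -> f =1 g.
Proof.
by move=> h t; rewrite (tensor_sum t) !linear_sum; apply: eq_bigr => x _.
Qed.

End TensorDef.

Arguments tens {K V W}.
Arguments tlift {K V W U b} hb.

Section TensorMaps.
Variable K : fieldType.
Implicit Types U V W X : lmodType K.

Fact tmap_bilin V W V' W' (f : {linear V -> V'}) (g : {linear W -> W'}) :
  bilin (fun v w => tens (f v) (g w)).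
Proof.
split=> [w a v v'|v a w w'] /=; rewrite linearP; first by rewrite (tens_bilin _ _).1.
by rewrite (tens_bilin _ _).2.
Qed.

Definition tmap V W V' W' (f : {linear V -> V'}) (g : {linear W -> W'}) :
  {linear tensor V W -> tensor V' W'} := tlift (tmap_bilin f g).

Fact tswap_bilin V W : bilin (fun (v : V) (w : W) => tens w v).
Proof.
by split=> [w|v] ? ? ?; [rewrite (tens_bilin _ _).2|rewrite (tens_bilin _ _).1].
Qed.

Definition tswap V W : {linear tensor V W -> tensor W V} :=
  tlift (@tswap_bilin V W).

Fact tassoc_bilin1 U V W (w : W) :
  bilin (fun (u : U) (v : V) => tens u (tens v w)).
Proof.
split=> [v|u] a x y; first by rewrite (tens_bilin _ _).1.
by rewrite (tens_bilin _ _).1 (tens_bilin _ _).2.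
Qed.

Fact tassoc_bilin U V W :
  bilin (fun (t : tensor U V) (w : W) => tlift (@tassoc_bilin1 U V W w) t).
Proof.
split=> [w|t] a x y; first exact: linearP.
rewrite /= !mklinE /tlift_fun /bisum scaler_sumr -big_split /=.
by apply: eq_bigr => i _; rewrite !(tens_bilin _ _).2.
Qed.

Definition tassoc U V W :
  {linear tensor (tensor U V) W -> tensor U (tensor V W)} :=
  tlift (@tassoc_bilin U V W).

Fact tassocV_bilin1 U V W (u : U) :
  bilin (fun (v : V) (w : W) => tens (tens u v) w).
Proof.
split=> [w|v] a x y; last by rewrite (tens_bilin _ _).2.
by rewrite (tens_bilin _ _).2 (tens_bilin _ _).1.
Qed.

Fact tassocV_bilin U V W :
  bilin (fun (u : U) (t : tensor V W) => tlift (@tassocV_bilin1 U V W u) t).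
Proof.
split=> [t|u] a x y; last exact: linearP.
rewrite /= !mklinE /tlift_fun /bisum scaler_sumr -big_split /=.
by apply: eq_bigr => i _; rewrite !(tens_bilin _ _).1.
Qed.

Definition tassocV U V W :
  {linear tensor U (tensor V W) -> tensor (tensor U V) W} :=
  tlift (@tassocV_bilin U V W).

(* The canonical isomorphisms V ~ K (x) V, V ~ V (x) K and K (x) K ~ K. *)
Fact tunitl_linear V : linear (fun v : V => tens (1 : K^o) v).
Proof. by move=> a x y; rewrite (tens_bilin _ _).2. Qed.

Definition tunitl V : {linear V -> tensor K^o V} := mklin (@tunitl_linear V).

Fact tunitr_linear V : linear (fun v : V => tens v (1 : K^o)).
Proof. by move=> a x y; rewrite (tens_bilin _ _).1. Qed.

Definition tunitr V : {linear V -> tensor V K^o} := mklin (@tunitr_linear V).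

Fact kmul_bilin : bilin (fun a b : K^o => a * b : K^o).
Proof.
by split=> [b|a] c x y; rewrite ?mulrDl ?mulrDr -?scalerAl -?scalerAr.
Qed.

Definition kmul : {linear tensor K^o K^o -> K^o} := tlift kmul_bilin.

(* id (x) f (x) id on a fourfold tensor product, bracketed two by two. *)
Definition tmid U V W X V' W' (f : {linear tensor V W -> tensor W' V'}) :
  {linear tensor (tensor U V) (tensor W X)
          -> tensor (tensor U W') (tensor V' X)} :=
  tassocV U W' (tensor V' X) \o
  tmap (idfun : {linear U -> U})
    (tassoc W' V' X \o
     (tmap f (idfun : {linear X -> X}) \o tassocV V W X)) \o
  tassoc U V (tensor W X).

Definition tinterchange U V W X :
  {linear tensor (tensor U V) (tensor W X)
          -> tensor (tensor U W) (tensor V X)} :=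
  tmid U X (tswap V W).

(* beta_q : x (x) y |-> q ^ (m * n) y (x) x, for degrees m and n. *)
Definition braiding (q : K) (m n : nat) V W :
  {linear tensor V W -> tensor W V} := q ^+ (m * n) \*: tswap V W.

Lemma tmapE V W V' W' (f : {linear V -> V'}) (g : {linear W -> W'}) v w :
  tmap f g (tens v w) = tens (f v) (g w).
Proof. exact: tliftE. Qed.

Lemma tswapE V W (v : V) (w : W) : tswap V W (tens v w) = tens w v.
Proof. exact: tliftE. Qed.

Lemma tassocE U V W (u : U) (v : V) (w : W) :
  tassoc U V W (tens (tens u v) w) = tens u (tens v w).
Proof. by rewrite !tliftE. Qed.

Lemma tassocVE U V W (u : U) (v : V) (w : W) :
  tassocV U V W (tens u (tens v w)) = tens (tens u v) w.
Proof. by rewrite !tliftE. Qed.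

Lemma tinterchangeE U V W X (u : U) (v : V) (w : W) (x : X) :
  tinterchange U V W X (tens (tens u v) (tens w x)) =
  tens (tens u w) (tens v x).
Proof.
by rewrite /tinterchange /tmid /= tassocE tmapE /= tassocVE tmapE tswapE
  tassocE tassocVE.
Qed.

End TensorMaps.

Definition idl (K : fieldType) (V : lmodType K) : {linear V -> V} := idfun.

Record bij (A B : finType) := Bij {
  bij_fun :> A -> B;
  bij_funP : bijective bij_fun
}.

Lemma bij_eq (A B : finType) (f g : bij A B) : f =1 g -> f = g.
Proof.
case: f g => [f hf] [g hg] /= /funext e; case: g / e hg => hg.
by rewrite (Prop_irrelevance hf hg).
Qed.

Definition bid (A : finType) : bij A A := @Bij A A id (inv_bij (fun=> erefl)).

Definition bcomp (A B C : finType) (g : bij B C) (f : bij A B) : bij A C :=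
  Bij (bij_comp (bij_funP g) (bij_funP f)).

Record species (K : fieldType) := Species {
  sp_obj :> finType -> lmodType K;
  sp_map : forall A B : finType, bij A B -> {linear sp_obj A -> sp_obj B};
  sp_id : forall (A : finType) x, sp_map (bid A) x = x;
  sp_comp : forall (A B C : finType) (g : bij B C) (f : bij A B) x,
    sp_map (bcomp g f) x = sp_map g (sp_map f x)
}.
Arguments sp_map {K} s {A B} f.

Record sp_morph (K : fieldType) (p q : species K) := SpMorph {
  sp_fun :> forall A : finType, {linear p A -> q A};
  sp_natural : forall (A B : finType) (f : bij A B) x,
    sp_fun B (sp_map p f x) = sp_map q f (sp_fun A x)
}.

Definition connected (K : fieldType) (p : species K) : Prop :=
  exists f : {linear K^o -> p void}, bijective f.

Definition positive (K : fieldType) (p : species K) : Prop :=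
  forall x : p void, x = 0.

(* Decompositions I = S |_| T are stated for subsets I, S, T of an arbitrary
   ambient finite type X; a subset is turned into an object of the category of
   finite sets by sub. *)
Definition sub (X : finType) (S : {set X}) : finType := {x : X | x \in S}.

Section Decompositions.
Variable X : finType.
Implicit Types I S T : {set X}.

Definition decomp I S T : bool := (I == S :|: T) && (S :&: T == set0).

Definition decomposition I : finType :=
  {d : {set X} * {set X} | decomp I d.1 d.2}.

Lemma decomp0l I : decomp I set0 I.
Proof. by rewrite /decomp set0U set0I !eqxx. Qed.

Lemma decomp0r I : decomp I I set0.
Proof. by rewrite /decomp setU0 setI0 !eqxx. Qed.

Section Refinement.
Variables I S T S' T' : {set X}.
Hypotheses (d : decomp I S T) (d' : decomp I S' T').

Lemma decomp_sub (Y : {set X}) : Y \subset I -> decomp Y (Y :&: S') (Y :&: T').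
Proof.
move: d' => /andP[/eqP eI' /eqP e0] sY.
by rewrite /decomp -setIUr -eI' (setIidPl sY) setIACA e0 setI0 !eqxx.
Qed.

Lemma decompAB : decomp S (S :&: S') (S :&: T').
Proof. by apply: decomp_sub; move: d => /andP[/eqP-> _]; exact: subsetUl. Qed.

Lemma decompCD : decomp T (T :&: S') (T :&: T').
Proof. by apply: decomp_sub; move: d => /andP[/eqP-> _]; exact: subsetUr. Qed.

End Refinement.

Lemma decompAC I S T S' T' (d : decomp I S T) (d' : decomp I S' T') :
  decomp S' (S :&: S') (T :&: S').
Proof. by rewrite !(setIC _ S'); exact: decompAB d' d. Qed.

Lemma decompBD I S T S' T' (d : decomp I S T) (d' : decomp I S' T') :
  decomp T' (S :&: T') (T :&: T').
Proof. by rewrite !(setIC _ T'); exact: decompCD d' d. Qed.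

Definition of_set0 (x : sub (set0 : {set X})) : void :=
  False_rect void (elimF idP (in_set0 (val x)) (valP x)).

Fact to_set0_bij : bijective (of_void (sub (set0 : {set X}))).
Proof. by exists of_set0 => [[]|[x hx]] //; have := hx; rewrite in_set0. Qed.

Fact of_set0_bij : bijective of_set0.
Proof. by exists (of_void _) => [[x hx]|[]] //; have := hx; rewrite in_set0. Qed.

Definition to_set0b : bij void (sub set0) := Bij to_set0_bij.
Definition of_set0b : bij (sub set0) void := Bij of_set0_bij.

End Decompositions.

(* g is the restriction to the subset S of the bijection f of I. *)
Definition restricts (X Y : finType) (I S : {set X}) (I' S' : {set Y})
    (f : bij (sub I) (sub I')) (g : bij (sub S) (sub S')) : Prop :=
  forall (x : sub I) (y : sub S), val x = val y -> val (f x) = val (g y).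

Section Monoids.
Variable K : fieldType.

Record monoid_ops (p : species K) := MonoidOps {
  mu : forall (X : finType) (I S T : {set X}), decomp I S T ->
    {linear tensor (p (sub S)) (p (sub T)) -> p (sub I)};
  iota : {linear K^o -> p void}
}.

Record comonoid_ops (p : species K) := ComonoidOps {
  comu : forall (X : finType) (I S T : {set X}), decomp I S T ->
    {linear p (sub I) -> tensor (p (sub S)) (p (sub T))};
  eps : {linear p void -> K^o}
}.

Arguments mu {p} m {X I S T} d.
Arguments comu {p} c {X I S T} d.

Variable p : species K.
Implicit Types (m : monoid_ops p) (c : comonoid_ops p).

(* Every empty set is uniquely isomorphic to void; these are the unit and the
   counit at the empty subset of X. *)
Definition iota0 m (X : finType) : {linear K^o -> p (sub (set0 : {set X}))} :=
  sp_map p (to_set0b X) \o iota m.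

Definition eps0 c (X : finType) : {linear p (sub (set0 : {set X})) -> K^o} :=
  eps c \o sp_map p (of_set0b X).

Record is_monoid m : Prop := IsMonoid {
  mu_natural : forall (X Y : finType) (I S T : {set X}) (I' S' T' : {set Y})
    (d : decomp I S T) (d' : decomp I' S' T') (f : bij (sub I) (sub I'))
    (g : bij (sub S) (sub S')) (h : bij (sub T) (sub T')),
    restricts f g -> restricts f h -> forall x,
    sp_map p f (mu m d x) = mu m d' (tmap (sp_map p g) (sp_map p h) x);
  mu_assoc : forall (X : finType) (I R S T RS ST : {set X})
    (dRS : decomp RS R S) (dRS_T : decomp I RS T)
    (dST : decomp ST S T) (dR_ST : decomp I R ST) x,
    mu m dRS_T (tmap (mu m dRS) (idl _) x) =
    mu m dR_ST (tmap (idl _) (mu m dST) (tassoc _ _ _ x));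
  mu_unitl : forall (X : finType) (I : {set X}) x,
    mu m (decomp0l I) (tmap (iota0 m X) (idl _) (tunitl _ x)) = x;
  mu_unitr : forall (X : finType) (I : {set X}) x,
    mu m (decomp0r I) (tmap (idl _) (iota0 m X) (tunitr _ x)) = x
}.

Record is_comonoid c : Prop := IsComonoid {
  comu_natural : forall (X Y : finType) (I S T : {set X}) (I' S' T' : {set Y})
    (d : decomp I S T) (d' : decomp I' S' T') (f : bij (sub I) (sub I'))
    (g : bij (sub S) (sub S')) (h : bij (sub T) (sub T')),
    restricts f g -> restricts f h -> forall x,
    comu c d' (sp_map p f x) = tmap (sp_map p g) (sp_map p h) (comu c d x);
  comu_assoc : forall (X : finType) (I R S T RS ST : {set X})
    (dRS : decomp RS R S) (dRS_T : decomp I RS T)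
    (dST : decomp ST S T) (dR_ST : decomp I R ST) x,
    tassoc _ _ _ (tmap (comu c dRS) (idl _) (comu c dRS_T x)) =
    tmap (idl _) (comu c dST) (comu c dR_ST x);
  comu_unitl : forall (X : finType) (I : {set X}) x,
    tmap (eps0 c X) (idl _) (comu c (decomp0l I) x) = tunitl _ x;
  comu_unitr : forall (X : finType) (I : {set X}) x,
    tmap (idl _) (eps0 c X) (comu c (decomp0r I) x) = tunitr _ x
}.

Record is_bimonoid (q : K) m c : Prop := IsBimonoid {
  bim_monoid : is_monoid m;
  bim_comonoid : is_comonoid c;
  bim_comu_mu : forall (X : finType) (I S T S' T' : {set X})
    (d : decomp I S T) (d' : decomp I S' T') x,
    comu c d' (mu m d x) =
    tmap (mu m (decompAC d d')) (mu m (decompBD d d'))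
      (tmid _ _ (braiding q #|S :&: T'| #|T :&: S'| _ _)
        (tmap (comu c (decompAB d d')) (comu c (decompCD d d')) x));
  bim_eps_iota : forall a, eps c (iota m a) = a;
  bim_eps_mu : forall (X : finType) x,
    eps0 c X (mu m (decomp0l set0) x) = kmul K (tmap (eps0 c X) (eps0 c X) x);
  bim_comu_iota : forall (X : finType) a,
    comu c (decomp0l set0) (iota0 m X a) =
    tmap (iota0 m X) (iota0 m X) (tunitl _ a)
}.

Definition conv m c (s t : forall A : finType, {linear p A -> p A})
    (X : finType) (I : {set X}) (x : p (sub I)) : p (sub I) :=
  \sum_(d : decomposition I)
    mu m (valP d) (tmap (s _) (t _) (comu c (valP d) x)).

Record is_antipode m c (s : sp_morph p p) : Prop := IsAntipode {
  antipode_r0 : forall (X : finType) (x : p (sub (set0 : {set X}))),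
    conv m c (fun A => idl (p A)) s x = iota0 m X (eps0 c X x);
  antipode_l0 : forall (X : finType) (x : p (sub (set0 : {set X}))),
    conv m c s (fun A => idl (p A)) x = iota0 m X (eps0 c X x);
  antipode_r : forall (X : finType) (I : {set X}), I != set0 ->
    forall x : p (sub I), conv m c (fun A => idl (p A)) s x = 0;
  antipode_l : forall (X : finType) (I : {set X}), I != set0 ->
    forall x : p (sub I), conv m c s (fun A => idl (p A)) x = 0
}.

Definition is_hopf (q : K) m c : Prop :=
  is_bimonoid q m c /\ exists s : sp_morph p p, is_antipode m c s.

End Monoids.

Arguments mu {K p} m {X I S T} d.
Arguments comu {K p} c {X I S T} d.

Record is_monoid_morph (K : fieldType) (p q : species K) (m : monoid_ops p)
    (n : monoid_ops q) (phi : sp_morph p q) : Prop := IsMonoidMorph {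
  morph_mu : forall (X : finType) (I S T : {set X}) (d : decomp I S T) x,
    phi _ (mu m d x) = mu n d (tmap (phi _) (phi _) x);
  morph_iota : forall a, phi _ (iota m a) = iota n a
}.

Definition monoid_iso (K : fieldType) (p q : species K) (m : monoid_ops p)
    (n : monoid_ops q) : Prop :=
  exists (phi : sp_morph p q) (psi : sp_morph q p),
    [/\ is_monoid_morph m n phi, is_monoid_morph n m psi,
        forall A x, psi A (phi A x) = x & forall A x, phi A (psi A x) = x].

Section Hadamard.
Variables (K : fieldType) (p q : species K).

Definition had_obj (A : finType) : lmodType K := tensor (p A) (q A).

Definition had_map (A B : finType) (f : bij A B) :
  {linear had_obj A -> had_obj B} := tmap (sp_map p f) (sp_map q f).

Fact had_id A x : had_map (bid A) x = x.
Proof.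
apply: (tensor_ext (f := had_map _) (g := idl _)) => v w.
by rewrite /had_map tmapE !sp_id.
Qed.

Fact had_comp A B C (g : bij B C) (f : bij A B) x :
  had_map (bcomp g f) x = had_map g (had_map f x).
Proof.
apply: (tensor_ext (f := had_map _) (g := had_map g \o had_map f)) => v w.
by rewrite /= /had_map !tmapE !sp_comp.
Qed.

Definition hadamard : species K := Species had_id had_comp.

Definition hadamard_monoid (m : monoid_ops p) (n : monoid_ops q) :
  monoid_ops hadamard :=
  @MonoidOps K hadamard
    (fun X I S T d => tmap (mu m d) (mu n d) \o tinterchange _ _ _ _)
    (tmap (iota m) (iota n) \o tunitl K^o).

Definition hadamard_comonoid (c : comonoid_ops p) (e : comonoid_ops q) :
  comonoid_ops hadamard :=
  @ComonoidOps K hadamard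
    (fun X I S T d => tinterchange _ _ _ _ \o tmap (comu c d) (comu e d))
    (kmul K \o tmap (eps c) (eps e)).

End Hadamard.

Section Compositions.
Variable I : finType.

Definition is_compn (F : seq {set I}) : bool :=
  [&& set0 \notin F, pairwise (fun S T : {set I} => [disjoint S & T]) F
    & \bigcup_(S <- F) S == setT].

Record compn := Compn { cseq :> seq {set I}; cseqP : is_compn cseq }.

HB.instance Definition _ := [isSub for cseq].
HB.instance Definition _ := [Countable of compn by <:].

Lemma is_compn_uniq F : is_compn F -> uniq F.
Proof.
case/and3P=> h0 + _; elim: F h0 => //= S F IH.
rewrite inE negb_or => /andP[S0 h0] /andP[/allP hS /(IH h0) ->].
rewrite andbT; apply/negP => /hS; rewrite -setI_eq0 setIid => /eqP e.
by rewrite e eqxx in S0.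
Qed.

Fact compn_size (F : compn) : (size F <= #|{set I}|)%N.
Proof. by have /card_uniqP <- := is_compn_uniq (cseqP F); exact: max_card. Qed.

Definition compn_bseq (F : compn) : (#|{set I}|).-bseq {set I} :=
  Bseq (compn_size F).

Fact compn_bseqK :
  pcancel compn_bseq (fun s => insub (s : seq {set I})).
Proof. by move=> F; rewrite valK. Qed.

HB.instance Definition _ : isFinite compn := PCanIsFinite compn_bseqK.

End Compositions.

(* The index type J is finite, so the direct sum consists of all families. *)
Section DirectSum.
Variables (K : fieldType) (J : finType) (M : J -> lmodType K).

Definition dirsum := {dffun forall j, M j}.
HB.instance Definition _ := Choice.on dirsum.

Implicit Types x y : dirsum.
Definition ds_zero : dirsum := [ffun j => 0 : M j].
Definition ds_add x y : dirsum := [ffun j => x j + y j : M j].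
Definition ds_opp x : dirsum := [ffun j => - x j : M j].
Definition ds_scale (a : K) x : dirsum := [ffun j => a *: x j : M j].

Fact ds_addA : associative ds_add.
Proof. by move=> x y z; apply/ffunP=> j; rewrite !ffunE addrA. Qed.
Fact ds_addC : commutative ds_add.
Proof. by move=> x y; apply/ffunP=> j; rewrite !ffunE addrC. Qed.
Fact ds_add0 : left_id ds_zero ds_add.
Proof. by move=> x; apply/ffunP=> j; rewrite !ffunE add0r. Qed.
Fact ds_addN : left_inverse ds_zero ds_opp ds_add.
Proof. by move=> x; apply/ffunP=> j; rewrite !ffunE addNr. Qed.

HB.instance Definition _ :=
  GRing.isZmodule.Build dirsum ds_addA ds_addC ds_add0 ds_addN.

Fact ds_scaleA a c x : ds_scale a (ds_scale c x) = ds_scale (a * c) x.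
Proof. by apply/ffunP=> j; rewrite !ffunE scalerA. Qed.
Fact ds_scale1 : left_id 1 ds_scale.
Proof. by move=> x; apply/ffunP=> j; rewrite !ffunE scale1r. Qed.
Fact ds_scaleDr : right_distributive ds_scale ds_add.
Proof. by move=> a x y; apply/ffunP=> j; rewrite !ffunE scalerDr. Qed.
Fact ds_scaleDl x : {morph ds_scale^~ x : a c / a + c >-> ds_add a c}.
Proof. by move=> a c; apply/ffunP=> j; rewrite !ffunE scalerDl. Qed.

HB.instance Definition _ :=
  GRing.Zmodule_isLmodule.Build K dirsum ds_scaleA ds_scale1
    ds_scaleDr ds_scaleDl.

Definition dinj_fun j (v : M j) : dirsum :=
  [ffun k => dfwith (fun k => 0 : M k) v k].

Fact dinj_linear j : linear (@dinj_fun j).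
Proof.
move=> a u v; apply/ffunP=> k; rewrite /dinj_fun !ffunE.
case: dfwithP => [|i ij]; first by rewrite !dfwith_in.
by rewrite !dfwith_out // scaler0 addr0.
Qed.

Definition dinj j : {linear M j -> dirsum} := mklin (@dinj_linear j).

Fact dproj_linear j : linear (fun x : dirsum => x j).
Proof. by move=> a x y; rewrite !ffunE. Qed.

Definition dproj j : {linear dirsum -> M j} := mklin (@dproj_linear j).

Lemma dirsum_sum x : x = \sum_j dinj j (x j).
Proof.
apply/ffunP=> k; rewrite -[RHS](mklinE (@dproj_linear k)) linear_sum.
rewrite (bigD1 k) //= big1 => [|j jk]; rewrite !mklinE ffunE.
  by rewrite dfwith_in addr0.
by rewrite dfwith_out.
Qed.

Definition dlift_fun (U : lmodType K) (f : forall j, {linear M j -> U}) x : U :=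
  \sum_j f j (x j).

Fact dlift_linear (U : lmodType K) (f : forall j, {linear M j -> U}) :
  linear (dlift_fun f).
Proof.
move=> a x y; rewrite /dlift_fun scaler_sumr -big_split /=.
by apply: eq_bigr => j _; rewrite !ffunE linearP.
Qed.

Definition dlift (U : lmodType K) (f : forall j, {linear M j -> U}) :
  {linear dirsum -> U} := mklin (dlift_linear f).

Lemma dliftE (U : lmodType K) (f : forall j, {linear M j -> U}) j v :
  dlift f (dinj j v) = f j v.
Proof.
rewrite mklinE /dlift_fun (bigD1 j) //= big1 => [|i ij]; rewrite mklinE ffunE.
  by rewrite dfwith_in addr0.
by rewrite dfwith_out 1?eq_sym // linear0.
Qed.

End DirectSum.

Section ImageBijection.
Variables (A B : finType) (i : A -> B) (hi : injective i) (S : {set A}).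

Definition im_fun (x : sub S) : sub (i @: S) :=
  exist _ (i (val x)) (imset_f i (valP x)).

Fact im_bij : bijective im_fun.
Proof.
apply: inj_card_bij => [x y [/hi e]|]; first exact: val_inj.
by rewrite !card_sig !cardE -!cardE card_imset.
Qed.

Definition imb : bij (sub S) (sub (i @: S)) := Bij im_bij.

End ImageBijection.

Section FreeMonoid.
Variables (K : fieldType) (q : species K).

(* q(F) for F = (I_1, ..., I_k): the product q[I_1] (x) (... (x) (q[I_k] (x) K)),
   where the final factor K is the value at the empty sequence. *)
Fixpoint cten (A : finType) (F : seq {set A}) : lmodType K :=
  if F is C :: F' then tensor (q (sub C)) (cten F') else K^o.

Fixpoint cmap (A B : finType) (i : A -> B) (hi : injective i)
    (F : seq {set A}) : {linear cten F -> cten [seq i @: C | C : {set A} <- F]} :=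
  match F return {linear cten F -> cten [seq i @: C | C : {set A} <- F]} with
  | [::] => idl K^o
  | C :: F' => tmap (sp_map q (imb hi C)) (cmap hi F')
  end.

Fact kscale_bilin (V : lmodType K) : bilin (fun (a : K^o) (v : V) => a *: v).
Proof.
split=> [v|a] c x y; first by rewrite /= scalerDl [in RHS]scalerA.
by rewrite /= scalerDr !scalerA mulrC.
Qed.

(* The canonical isomorphism q(F) (x) q(G) ~ q(F . G). *)
Fixpoint ccat (A : finType) (F G : seq {set A}) :
    {linear tensor (cten F) (cten G) -> cten (F ++ G)} :=
  match F return {linear tensor (cten F) (cten G) -> cten (F ++ G)} with
  | [::] => tlift (kscale_bilin (cten G))
  | C :: F' => tmap (idl (q (sub C))) (ccat F' G) \o tassoc _ _ _
  end.

Definition free_obj (A : finType) : lmodType K :=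
  @dirsum K (compn A) (fun F => cten F).

Definition cinj (A : finType) (F : compn A) : {linear cten F -> free_obj A} :=
  dinj (fun G : compn A => cten G) F.

Fact im_compn (A B : finType) (f : bij A B) (F : compn A) :
  is_compn [seq f @: C | C : {set A} <- F].
Proof.
have fI := bij_inj (bij_funP f).
case: F => F /= /and3P[h0 hd /eqP hU]; apply/and3P; split.
- by apply: contra h0 => /mapP[S SF /esym/eqP]; rewrite imset_eq0 => /eqP <-.
- rewrite pairwise_map; apply: sub_pairwise hd => S T /=.
  by rewrite -!setI_eq0 -imsetI ?imset_eq0 // => x y _ _; exact: fI.
- rewrite big_map -(big_morph (fun S : {set A} => f @: S)
    (imsetU f) (imset0 f)) hU; apply/eqP/setP=> y; rewrite inE.
  by have [g _ gK] := bij_funP f; rewrite -(gK y) imset_f.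
Qed.

Definition compn_im (A B : finType) (f : bij A B) (F : compn A) : compn B :=
  Compn (im_compn f F).

Definition free_map (A B : finType) (f : bij A B) :
    {linear free_obj A -> free_obj B} :=
  dlift (fun F : compn A =>
    cinj (compn_im f F) \o cmap (bij_inj (bij_funP f)) F).

Lemma cinj_sum (A : finType) (x : free_obj A) :
  x = \sum_(F : compn A) cinj F (x F).
Proof. exact: dirsum_sum. Qed.

Lemma free_mapE (A B : finType) (f : bij A B) (F : compn A) v :
  free_map f (cinj F v) =
  cinj (compn_im f F) (cmap (bij_inj (bij_funP f)) F v).
Proof. exact: dliftE. Qed.

Definition ccast (A : finType) (F G : seq {set A}) (e : F = G) (x : cten F) :
  cten G := ecast H (cten H) e x.

Definition eqb_sub (A : finType) (C D : {set A}) (e : C = D) :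
    bij (sub C) (sub D) :=
  ecast H (bij (sub C) (sub H)) e (bid (sub C)).

Lemma eqb_subE (A : finType) (C D : {set A}) (e : C = D) x :
  val (eqb_sub e x) = val x.
Proof. by case: D / e. Qed.

Fact ccast_linear (A : finType) (F G : seq {set A}) (e : F = G) :
  linear (ccast e).
Proof. by case: G / e. Qed.

Lemma ccast_cons (A : finType) (C D : {set A}) (F G : seq {set A})
    (e : C :: F = D :: G) (e1 : C = D) (e2 : F = G) v w :
  @ccast A (C :: F) (D :: G) e (tens v w) =
  tens (sp_map q (eqb_sub e1) v) (ccast e2 w).
Proof.
case: D / e1 e => e; case: G / e2 e => e.
by rewrite (eq_irrelevance e erefl) /= sp_id.
Qed.

Lemma cinj_cast (A : finType) (F G : compn A) (e : cseq F = cseq G) x :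
  cinj G (ccast e x) = cinj F x.
Proof.
have /= eFG : F = G by exact: val_inj.
by case: G / eFG e => e; rewrite (eq_irrelevance e erefl).
Qed.

Lemma cmap_id (A : finType) (i : A -> A) (hi : injective i) (F : seq {set A})
    (e : [seq i @: C | C : {set A} <- F] = F) (x : cten F) :
  i =1 id -> ccast e (cmap hi F x) = x.
Proof.
move=> i_id; elim: F e x => [|C F IH] e x.
  by rewrite (eq_irrelevance e erefl).
have [e1 e2] : i @: C = C /\ [seq i @: C | C : {set A} <- F] = F by case: e.
rewrite -(mklinE (ccast_linear e)).
apply: (tensor_ext (f := mklin (ccast_linear e) \o cmap hi (C :: F))
  (g := idl _)) => v w.
rewrite /= mklinE tmapE ccast_cons IH -sp_comp.
suff -> : bcomp (eqb_sub e1) (imb hi C) = bid (sub C) by rewrite sp_id.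
by apply: bij_eq => y; apply: val_inj; rewrite /= eqb_subE /= i_id.
Qed.

Lemma cmap_comp (A B D : finType) (f : A -> B) (g : B -> D) (h : A -> D)
    (hf : injective f) (hg : injective g) (hh : injective h) (F : seq {set A})
    (e : [seq h @: C | C : {set A} <- F] =
         [seq g @: C | C : {set B} <- [seq f @: C | C : {set A} <- F]])
    (x : cten F) :
  h =1 g \o f -> ccast e (cmap hh F x) = cmap hg _ (cmap hf F x).
Proof.
move=> h_gf; elim: F e x => [|C F IH] e x.
  by rewrite (eq_irrelevance e erefl).
have [e1 e2] : h @: C = g @: (f @: C) /\ [seq h @: C | C : {set A} <- F] =
    [seq g @: C | C : {set B} <- [seq f @: C | C : {set A} <- F]] by case: e.
rewrite -(mklinE (ccast_linear e)).
apply: (tensor_ext (f := mklin (ccast_linear e) \o cmap hh (C :: F))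
  (g := cmap hg _ \o cmap hf (C :: F))) => v w.
rewrite /= mklinE !tmapE ccast_cons IH -!sp_comp.
congr (tens (sp_map q _ v) _); apply: bij_eq => y; apply: val_inj.
by rewrite /= eqb_subE /= h_gf.
Qed.

Fact free_id (A : finType) (x : free_obj A) : free_map (bid A) x = x.
Proof.
rewrite [RHS]dirsum_sum [LHS]mklinE; apply: eq_bigr => F _ /=.
have e : cseq (compn_im (bid A) F) = F.
  by rewrite /= -[RHS]map_id; apply: eq_map => C; exact: imset_id.
by rewrite -(cinj_cast e) cmap_id.
Qed.

Fact free_comp (A B D : finType) (g : bij B D) (f : bij A B) (x : free_obj A) :
  free_map (bcomp g f) x = free_map g (free_map f x).
Proof.
rewrite {1 2}(cinj_sum x) !linear_sum; apply: eq_bigr => F _.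
rewrite !free_mapE.
have e : cseq (compn_im (bcomp g f) F) = compn_im g (compn_im f F).
  by rewrite /= -map_comp; apply: eq_map => C; rewrite /= -imset_comp.
by rewrite -(cinj_cast e) (cmap_comp (bij_inj (bij_funP f))
  (bij_inj (bij_funP g))).
Qed.

Definition free_species : species K := Species free_id free_comp.

Definition incl (X : finType) (S I : {set X}) (sSI : S \subset I)
    (x : sub S) : sub I := exist _ (val x) (subsetP sSI _ (valP x)).

Fact incl_inj (X : finType) (S I : {set X}) (sSI : S \subset I) :
  injective (incl sSI).
Proof. by move=> x y /(congr1 val) /= /val_inj. Qed.

Section Product.
Variables (X : finType) (I S T : {set X}) (d : decomp I S T).

Fact decomp_subl : S \subset I.
Proof. by move: d => /andP[/eqP-> _]; exact: subsetUl. Qed.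

Fact decomp_subr : T \subset I.
Proof. by move: d => /andP[/eqP-> _]; exact: subsetUr. Qed.

Let iS := incl decomp_subl.
Let iT := incl decomp_subr.

Fact inclU : iS @: setT :|: iT @: setT = setT.
Proof.
apply/setP=> -[x xI]; rewrite !inE.
have : x \in S :|: T by rewrite -(eqP (andP d).1).
rewrite inE => /orP[xS|xT]; apply/orP; [left|right].
  by apply/imsetP; exists (exist _ x xS) => //; exact: val_inj.
by apply/imsetP; exists (exist _ x xT) => //; exact: val_inj.
Qed.

Fact incl_disjoint (C : {set sub S}) (D : {set sub T}) :
  [disjoint iS @: C & iT @: D].
Proof.
rewrite -setI_eq0; apply/eqP/setP=> z; rewrite !inE; apply/negP.
case/andP=> /imsetP[x _ ->] /imsetP[y _ /(congr1 val) /= e].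
have : val x \in S :&: T 
  by apply/setIP; split; [exact: valP|rewrite [val x]e; exact: valP].
by rewrite (eqP (andP d).2) inE.
Qed.

Fact concat_compn (F : compn (sub S)) (G : compn (sub T)) :
  is_compn ([seq iS @: C | C : {set sub S} <- F] ++
            [seq iT @: C | C : {set sub T} <- G]).
Proof.
case: F G => F /= /and3P[hF dF /eqP uF] [G /= /and3P[hG dG /eqP uG]].
have inS := @incl_inj _ _ _ decomp_subl.
have inT := @incl_inj _ _ _ decomp_subr.
apply/and3P; split.
- rewrite mem_cat negb_or; apply/andP; split.
    by apply: contra hF => /mapP[C CF /esym/eqP]; rewrite imset_eq0 => /eqP <-.
  by apply: contra hG => /mapP[C CF /esym/eqP]; rewrite imset_eq0 => /eqP <-.
- rewrite pairwise_cat !pairwise_map; apply/and3P; split.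
  + by apply/allrelP=> _ _ /mapP[C _ ->] /mapP[D _ ->]; exact: incl_disjoint.
  + apply: sub_pairwise dF => C D /=.
    by rewrite -!setI_eq0 -imsetI ?imset_eq0 // => x y _ _; exact: inS.
  + apply: sub_pairwise dG => C D /=.
    by rewrite -!setI_eq0 -imsetI ?imset_eq0 // => x y _ _; exact: inT.
- rewrite big_cat !big_map /=.
  rewrite -(big_morph (fun C : {set sub S} => iS @: C) (imsetU iS) (imset0 iS)).
  rewrite -(big_morph (fun C : {set sub T} => iT @: C) (imsetU iT) (imset0 iT)).
  by rewrite uF uG inclU.
Qed.

Definition compn_concat (F : compn (sub S)) (G : compn (sub T)) :
  compn (sub I) := Compn (concat_compn F G).

Definition free_mu_fun (x : free_obj (sub S)) (y : free_obj (sub T)) :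
    free_obj (sub I) :=
  \sum_(F : compn (sub S)) \sum_(G : compn (sub T))
    cinj (compn_concat F G)
      (ccat _ _ (tens (cmap (@incl_inj _ _ _ decomp_subl) F (x F))
                      (cmap (@incl_inj _ _ _ decomp_subr) G (y G)))).

Fact free_mu_bilin : bilin free_mu_fun.
Proof.
split=> [y|x] a u v; rewrite /= /free_mu_fun scaler_sumr -big_split /=;
  apply: eq_bigr => F _; rewrite scaler_sumr -big_split /=;
  apply: eq_bigr => G _; rewrite ffunE [in LHS]ffunE.
  by rewrite linearP (tens_bilin _ _).1 !linearP.
by rewrite linearP (tens_bilin _ _).2 !linearP.
Qed.

Definition free_mu :
    {linear tensor (free_obj (sub S)) (free_obj (sub T)) -> free_obj (sub I)} :=
  tlift free_mu_bilin.

End Product.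

Fact nil_compn : is_compn ([::] : seq {set void}).
Proof. by rewrite /is_compn /= big_nil; apply/eqP/setP => -[]. Qed.

Definition free_iota : {linear K^o -> free_obj void} := cinj (Compn nil_compn).

Definition free_monoid : monoid_ops free_species :=
  @MonoidOps K free_species free_mu free_iota.

End FreeMonoid.

Definition is_free (K : fieldType) (p : species K) (m : monoid_ops p) : Prop :=
  exists q : species K, positive q /\ monoid_iso m (free_monoid q).

(* Main.v *)
From HB Require Import structures.
From mathcomp Require Import all_boot all_order all_algebra.
From mathcomp Require Import boolp.
Require Import Defs.

Set Implicit Arguments.
Unset Strict Implicit.
Unset Printing Implicit Defensive.

Import GRing.Theory.
Local Open Scope ring_scope.

(** Write mu and Delta for the products and coproducts.

    The Hadamard product [h x k] is a bimonoid because all its structure maps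
    are tensor products of those of [h] and [k], up to the interchange of the
    two middle factors.  The only scalars are the powers [p ^+ (|B| * |C|)] and
    [q ^+ (|B| * |C|)] contributed by the two braidings, and they multiply to
    the power of [p * q] ([had_is_bimonoid]).  A free monoid takes the value [K]
    on the empty set, so [k], and hence [h x k], is connected.

    A connected bimonoid has an antipode: in the convolution algebra the
    identity is the unit minus a map [w] that vanishes on the empty set, and
    the Neumann series of [w] is finite on each finite set.  This gives a right
    inverse to every natural family that is the identity on empty sets, hence a
    two-sided inverse to the identity ([antipode_exists]).

    Freeness uses only the monoid structure of [k], so the coproduct of [k] may
    be replaced by a better one, namely deconcatenation of compositions, carried
    over from the free monoid.  For this coproduct
    [Delta_(S', T') mu_(S, T) = 0] whenever [S] and [S'] are incomparable: a
    concatenation [F . G] with [F] a composition of [S] never splits along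
    [S'].  Paired with the coproduct of [h] it gives [h x k] a new coproduct with
    the same vanishing.  The value of [p] does not matter: when [S] and [S'] are
    comparable, one of the two factors of [h] that the braiding exchanges lies
    over the empty set, so the compatibility axiom involves no power of [p].

    For each decomposition put [e_(S, T) = mu_(S, T) Delta_(S, T)]
    ([resplit]).  The three facts that matter are: [Delta_(S, T)] is a left
    inverse of [mu_(S, T)]; for nested [S] and [S'] the operators [e] pass
    through products ([nested_split]); for incomparable ones they kill products
    ([crossing_free]).  Under these conditions the [e_(S, T)] on the value at
    [I], for proper decompositions, are commuting idempotents.  Splitting with
    respect to all of them writes every element as a primitive one, killed by
    every [e_(S, T)], plus a sum of products over proper decompositions
    ([prod_ind]).

    Let [P] be the species of primitive elements.  The monoid morphism from the
    free monoid on [P] that extends the inclusion intertwines the operators [e]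
    on both sides ([psi_resplit]); induction on the cardinality then makes it
    bijective ([comparison_bij]).  It is onto because of the decomposition into
    primitives and products.  It is one-to-one because an element of its
    kernel is primitive by induction, the primitive elements of a free monoid
    are its one-block elements ([free_prim]), and these are mapped
    injectively. *)

(** * Tensor products *)

Section PureTensors.
Variable K : fieldType.
Implicit Types U V W X Y : lmodType K.

(** [linearZ] at the plain scaling, which keeps the unifier from searching for a
    scaling law. *)
Lemma linZ U V (f : {linear U -> V}) a u : f (a *: u) = a *: f u.
Proof. exact: linearZ. Qed.

Lemma tensDl V W (x y : V) (w : W) : tens (x + y) w = tens x w + tens y w.
Proof. by have := (tens_bilin V W).1 w 1 x y; rewrite /= !scale1r. Qed.

Lemma tensDr V W (v : V) (x y : W) : tens v (x + y) = tens v x + tens v y.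
Proof. by have := (tens_bilin V W).2 v 1 x y; rewrite /= !scale1r. Qed.

Lemma tens0l V W (w : W) : tens (0 : V) w = 0.
Proof. by apply: (addrI (tens 0 w)); rewrite -tensDl !addr0. Qed.

Lemma tens0r V W (v : V) : tens v (0 : W) = 0.
Proof. by apply: (addrI (tens v 0)); rewrite -tensDr !addr0. Qed.

Lemma tensZl V W a (v : V) (w : W) : tens (a *: v) w = a *: tens v w.
Proof. by have := (tens_bilin V W).1 w a v 0; rewrite /= !addr0 tens0l addr0. Qed.

Lemma tensZr V W a (v : V) (w : W) : tens v (a *: w) = a *: tens v w.
Proof. by have := (tens_bilin V W).2 v a w 0; rewrite /= !addr0 tens0r addr0. Qed.

Lemma tens_suml V W (I : Type) (r : seq I) (P : pred I) (F : I -> V) (w : W) :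
  tens (\sum_(i <- r | P i) F i) w = \sum_(i <- r | P i) tens (F i) w.
Proof. by apply: (big_morph (fun v => tens v w)) => [x y|]; rewrite ?tensDl ?tens0l. Qed.

Lemma tens_sumr V W (I : Type) (r : seq I) (P : pred I) (v : V) (F : I -> W) :
  tens v (\sum_(i <- r | P i) F i) = \sum_(i <- r | P i) tens v (F i).
Proof. by apply: (big_morph (tens v)) => [x y|]; rewrite ?tensDr ?tens0r. Qed.

(** The case of zero is left out because [0] is the pure tensor [tens 0 0]. *)
Lemma tensor_ind V W (P : tensor V W -> Prop) :
  (forall v w, P (tens v w)) -> (forall x y, P x -> P y -> P (x + y)) ->
  forall t, P t.
Proof.
move=> hp hD t; rewrite (tensor_sum t); elim/big_ind: _ => //.
by rewrite -(tens0l V (0 : W)).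
Qed.

Lemma tunitlE V (v : V) : tunitl V v = tens 1 v.
Proof. exact: mklinE. Qed.

Lemma tunitrE V (v : V) : tunitr V v = tens v 1.
Proof. exact: mklinE. Qed.

Lemma kmulE (a b : K^o) : kmul K (tens a b) = a * b.
Proof. exact: tliftE. Qed.

Lemma tmidE U V W X V' W' (f : {linear tensor V W -> tensor W' V'}) u v w x :
  tmid U X f (tens (tens u v) (tens w x)) =
  tassocV _ _ _ (tmap (idl U) (tassoc W' V' X) (tens u (tens (f (tens v w)) x))).
Proof. by rewrite /tmid /= tassocE tmapE /= tassocVE tmapE tmapE. Qed.

Lemma tmid_braidE (q : K) m n U V W X u v w x :
  tmid U X (braiding q m n V W) (tens (tens u v) (tens w x)) =
  q ^+ (m * n) *: tens (tens u w) (tens v x).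
Proof.
rewrite tmidE /braiding /= tswapE tensZl !tmapE linearZ /= tassocE.
by rewrite tensZr linearZ /= tassocVE.
Qed.

Lemma tmapZ V W V' W' (f : {linear V -> V'}) (g : {linear W -> W'}) a t :
  tmap f g (a *: t) = a *: tmap f g t.
Proof. exact: linZ. Qed.
End PureTensors.

(* Reduces an equation additive in the tensor t to the case of a pure tensor. *)
Ltac tind t :=
  let hx := fresh in let hy := fresh in
  elim/tensor_ind: t => [|? ? hx hy];
  last by rewrite ?(linearD, tensDl, tensDr) ?hx ?hy.

Section TensorMaps.
Variable K : fieldType.
Implicit Types U V W X Y : lmodType K.

Lemma tmap_inter U V W X U' V' W' X' (f : {linear U -> U'})
    (g : {linear V -> V'}) (f' : {linear W -> W'}) (g' : {linear X -> X'}) t :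
  tinterchange _ _ _ _ (tmap (tmap f g) (tmap f' g') t) =
  tmap (tmap f f') (tmap g g') (tinterchange U V W X t).
Proof.
tind t => t1 t2; tind t1 => u v; tind t2 => w x.
by rewrite tinterchangeE !tmapE tinterchangeE.
Qed.

Lemma tmap_assoc U V W U' V' W' (f : {linear U -> U'}) (g : {linear V -> V'})
    (h : {linear W -> W'}) t :
  tassoc _ _ _ (tmap (tmap f g) h t) = tmap f (tmap g h) (tassoc _ _ _ t).
Proof. by tind t => t1 w; tind t1 => u v; rewrite tassocE !tmapE tassocE. Qed.

Lemma tmap_comp U V W U' V' W' (f : {linear V -> W}) (g : {linear U -> V})
    (f' : {linear V' -> W'}) (g' : {linear U' -> V'}) t :
  tmap f f' (tmap g g' t) = tmap (f \o g) (f' \o g') t.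
Proof. by tind t => u v; rewrite !tmapE. Qed.

Lemma tmap_id V W t : tmap (idl V) (idl W) t = t.
Proof. by tind t => u v; rewrite !tmapE. Qed.

Lemma eq_tmap U V W X (f f' : {linear U -> V}) (g g' : {linear W -> X}) :
  f =1 f' -> g =1 g' -> tmap f g =1 tmap f' g'.
Proof. by move=> ef eg t; tind t => u v; rewrite !tmapE ef eg. Qed.

Lemma tmap0l U V W X (f : {linear U -> V}) (g : {linear W -> X}) :
  f =1 (fun=> 0) -> tmap f g =1 (fun=> 0).
Proof.
move=> f0; apply: (tensor_ind (P := fun t => tmap f g t = 0)) => [u v|x y hx hy].
  by rewrite tmapE f0 tens0l.
by rewrite linearD hx hy addr0.
Qed.

Lemma tmap0r U V W X (f : {linear U -> V}) (g : {linear W -> X}) :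
  g =1 (fun=> 0) -> tmap f g =1 (fun=> 0).
Proof.
move=> g0; apply: (tensor_ind (P := fun t => tmap f g t = 0)) => [u v|x y hx hy].
  by rewrite tmapE g0 tens0r.
by rewrite linearD hx hy addr0.
Qed.

End TensorMaps.

(** * The Hadamard product of bimonoids *)

Section HadamardBimonoid.
Variables (K : fieldType) (h k : species K).
Variables (mh : monoid_ops h) (mk : monoid_ops k).
Variables (ch : comonoid_ops h) (ck : comonoid_ops k).

Local Notation hk := (hadamard h k).
Local Notation mhk := (hadamard_monoid mh mk).
Local Notation chk := (hadamard_comonoid ch ck).

Lemma had_mapE A B (f : bij A B) (a : h A) (b : k A) :
  sp_map hk f (tens a b) = tens (sp_map h f a) (sp_map k f b).
Proof. exact: tmapE. Qed.

Lemma had_muE (X : finType) (I S T : {set X}) (d : decomp I S T) t :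
  mu mhk d t = tmap (mu mh d) (mu mk d) (tinterchange _ _ _ _ t).
Proof. by []. Qed.

Lemma had_mu_tens (X : finType) (I S T : {set X}) (d : decomp I S T) a b a' b' :
  mu mhk d (tens (tens a b) (tens a' b')) =
  tens (mu mh d (tens a a')) (mu mk d (tens b b')).
Proof. by rewrite had_muE tinterchangeE tmapE. Qed.

Lemma had_comu_tens (X : finType) (I S T : {set X}) (d : decomp I S T) a b :
  comu chk d (tens a b) = tinterchange _ _ _ _ (tens (comu ch d a) (comu ck d b)).
Proof. by rewrite /= tmapE. Qed.

Lemma had_iotaE a : iota mhk a = tens (iota mh 1) (iota mk a).
Proof. by rewrite /= tunitlE tmapE. Qed.

Lemma had_epsE a b : eps chk (tens a b) = eps ch a * eps ck b.
Proof. by rewrite /= tmapE kmulE. Qed.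

Lemma had_iota0E X a : iota0 mhk X a = tens (iota0 mh X 1) (iota0 mk X a).
Proof. by rewrite /iota0 -had_mapE -had_iotaE. Qed.

Lemma had_eps0E X a b : eps0 chk X (tens a b) = eps0 ch X a * eps0 ck X b.
Proof. by rewrite /eps0 -had_epsE -had_mapE. Qed.

Lemma had_is_monoid : is_monoid mh -> is_monoid mk -> is_monoid mhk.
Proof.
move=> Mh Mk; split.
- move=> X Y I S T I' S' T' d d' f g e rg re x.
  tind x => s t; tind s => a b; tind t => a' b'.
  rewrite had_mu_tens had_mapE (mu_natural Mh d d' rg re) (mu_natural Mk d d' rg re).
  by rewrite !tmapE ?had_mapE had_mu_tens.
- move=> X I R S T RS ST dRS dRS_T dST dR_ST x.
  tind x => rs t; tind rs => r s; tind r => a b; tind s => a' b'; tind t => a'' b''.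
  rewrite tassocE !tmapE !had_mu_tens.
  have := mu_assoc Mh dRS dRS_T dST dR_ST (tens (tens a a') a'').
  have := mu_assoc Mk dRS dRS_T dST dR_ST (tens (tens b b') b'').
  by rewrite !tassocE !tmapE => -> ->.
- move=> X I x; tind x => a b.
  have := mu_unitl Mh a; have := mu_unitl Mk b.
  rewrite !tunitlE !tmapE => eb ea.
  by rewrite had_iota0E had_mu_tens ea eb.
- move=> X I x; tind x => a b.
  have := mu_unitr Mh a; have := mu_unitr Mk b.
  rewrite !tunitrE !tmapE => eb ea.
  by rewrite had_iota0E had_mu_tens ea eb.
Qed.

(** The maps of [h] and of [k] can be separated from the interchanges that
    interleave them, by naturality of the interchange; what remains is the
    coassociativity or counit axiom of each factor. *)
Lemma had_is_comonoid : is_comonoid ch -> is_comonoid ck -> is_comonoid chk.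
Proof.
move=> Ch Ck; split.
- move=> X Y I S T I' S' T' d d' f g e rg re x.
  tind x => a b.
  rewrite had_mapE !had_comu_tens (comu_natural Ch d d' rg re).
  by rewrite (comu_natural Ck d d' rg re) -tmapE tmap_inter.
- move=> X I R S T RS ST dRS dRS_T dST dR_ST x; tind x => a b.
  rewrite !had_comu_tens.
  have := comu_assoc Ch dRS dRS_T dST dR_ST a.
  have := comu_assoc Ck dRS dRS_T dST dR_ST b.
  move: (comu ch _ a) (comu ck _ b) (comu ch _ a) (comu ck _ b) => u' v' u v ev eu.
  (* f and g interleave two threefold tensor products, bracketed to the left and
     to the right; fg is their compatibility with the associator. *)
  pose f R U T (t : tensor (tensor (h R) (h U)) (h T))
    (s : tensor (tensor (k R) (k U)) (k T)) :=
    tmap (tinterchange _ _ _ _) (idl _) (tinterchange _ _ _ _ (tens t s)).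
  pose g R U T (t : tensor (h R) (tensor (h U) (h T)))
    (s : tensor (k R) (tensor (k U) (k T))) :=
    tmap (idl _) (tinterchange _ _ _ _) (tinterchange _ _ _ _ (tens t s)).
  have fg A B C t s : tassoc _ _ _ (@f A B C t s) = g _ _ _ (tassoc _ _ _ t) (tassoc _ _ _ s).
    rewrite /f /g; tind t => t1 t2; tind t1 => t1 t3; tind s => s1 s2; tind s1 => s1 s3.
    by rewrite !tassocE !tinterchangeE !tmapE !tinterchangeE tassocE.
  transitivity (tassoc _ _ _ (f _ _ _ (tmap (comu ch dRS) (idl _) u)
    (tmap (comu ck dRS) (idl _) v))).
    rewrite /f {fg eu ev}; tind u => u1 u2; tind v => v1 v2.
    by rewrite !tmapE !tinterchangeE !tmapE had_comu_tens.
  rewrite fg eu ev /g {fg eu ev}; tind u' => u1 u2; tind v' => v1 v2.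
  by rewrite !tmapE !tinterchangeE !tmapE had_comu_tens.
- move=> X I x; tind x => a b; rewrite had_comu_tens tunitlE.
  have := comu_unitl Ch a; have := comu_unitl Ck b; rewrite !tunitlE.
  move: (comu ch _ a) (comu ck _ b) => u v ev eu.
  transitivity (tmap (kmul K) (idl _) (tinterchange _ _ _ _
    (tens (tmap (eps0 ch X) (idl _) u) (tmap (eps0 ck X) (idl _) v)))).
    rewrite {eu ev}; tind u => u1 u2; tind v => v1 v2.
    by rewrite !tmapE !tinterchangeE !tmapE had_eps0E kmulE.
  by rewrite eu ev tinterchangeE tmapE kmulE mul1r.
- move=> X I x; tind x => a b; rewrite had_comu_tens tunitrE.
  have := comu_unitr Ch a; have := comu_unitr Ck b; rewrite !tunitrE.
  move: (comu ch _ a) (comu ck _ b) => u v ev eu.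
  transitivity (tmap (idl _) (kmul K) (tinterchange _ _ _ _
    (tens (tmap (idl _) (eps0 ch X) u) (tmap (idl _) (eps0 ck X) v)))).
    rewrite {eu ev}; tind u => u1 u2; tind v => v1 v2.
    by rewrite !tmapE !tinterchangeE !tmapE had_eps0E kmulE.
  by rewrite eu ev tinterchangeE tmapE kmulE mul1r.
Qed.

(** Both braidings carry the same exponent, so the scalars [p ^+ n] and [q ^+ n]
    combine into [(p * q) ^+ n]. *)
Lemma had_is_bimonoid p q :
  is_bimonoid p mh ch -> is_bimonoid q mk ck -> is_bimonoid (p * q) mhk chk.
Proof.
move=> Bh Bk; split.
- exact: had_is_monoid (bim_monoid Bh) (bim_monoid Bk).
- exact: had_is_comonoid (bim_comonoid Bh) (bim_comonoid Bk).
- move=> X I S T S' T' d d' x.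
  tind x => s t; tind s => a b; tind t => a' b'.
  rewrite had_mu_tens had_comu_tens (bim_comu_mu Bh) (bim_comu_mu Bk).
  rewrite !tmapE !had_comu_tens.
  move: (comu ch _ a) (comu ch _ a') (comu ck _ b) (comu ck _ b') => u u' v v'.
  tind u => u1 u2; tind u' => u'1 u'2; tind v => v1 v2; tind v' => v'1 v'2.
  rewrite 2!tmid_braidE 2!tmapZ 2!tmapE tensZl tensZr scalerA linZ.
  rewrite 3!tinterchangeE tmid_braidE tmapZ tmapE.
  by rewrite exprMn mulrC 2!had_mu_tens.
- by move=> a; rewrite had_iotaE had_epsE (bim_eps_iota Bh) (bim_eps_iota Bk) mul1r.
- move=> X x; tind x => s t; tind s => a b; tind t => a' b'.
  rewrite had_mu_tens had_eps0E (bim_eps_mu Bh) (bim_eps_mu Bk).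
  by rewrite !tmapE !kmulE !had_eps0E mulrACA.
- move=> X a; rewrite had_iota0E had_comu_tens (bim_comu_iota Bh) (bim_comu_iota Bk).
  by rewrite !tunitlE !tmapE tinterchangeE !had_iota0E.
Qed.

End HadamardBimonoid.

(** * Decompositions and bijections *)

Section Bijections.

Lemma bij_of_inj_surj (A B : finType) (f : A -> B) :
  injective f -> (forall y, exists x, f x == y) -> bijective f.
Proof.
move=> fI fS; exists (fun y => xchoose (fS y)) => [x|y].
  by apply: fI; apply/eqP; exact: (xchooseP (fS (f x))).
exact/eqP/(xchooseP (fS y)).
Qed.

Lemma bij_inv_ex (A B : finType) (f : bij A B) :
  exists g : bij B A, cancel f g /\ cancel g f.
Proof.
have [g fK gK] := bij_funP f.
by exists (Bij (Bijective gK fK)).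
Qed.

(** Species are evaluated on arbitrary finite types, products only on subsets of
    an ambient type; [setTb] and [setTbV] pass from one setting to the other. *)
Definition setTb (A : finType) : bij A (sub [set: A]).
Proof.
apply: (@Bij _ _ (fun x => exist _ x (in_setT x))).
by exists val => // x; exact: val_inj.
Defined.

Definition setTbV (A : finType) : bij (sub [set: A]) A.
Proof.
by apply: (@Bij _ _ val); exists (setTb A) => // x; exact: val_inj.
Defined.

Lemma setTbK (A : finType) : bcomp (setTbV A) (setTb A) = bid A.
Proof. exact: bij_eq. Qed.

Lemma setTbVK (A : finType) : bcomp (setTb A) (setTbV A) = bid (sub [set: A]).
Proof. by apply: bij_eq => x; exact: val_inj. Qed.

Lemma decompP (X : finType) (I S T : {set X}) :
  reflect (I = S :|: T /\ [disjoint S & T]) (decomp I S T).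
Proof.
rewrite /decomp setI_eq0.
by apply: (iffP andP) => [[/eqP]|[/eqP]].
Qed.

Section Image.
Variables (X Y : finType) (I : {set X}) (J : {set Y}) (f : bij (sub I) (sub J)).

(** The image of a subset of [I], read in the ambient types, under a bijection
    between the subsets [I] and [J] of possibly different types. *)
Definition fimg (S : {set X}) : {set Y} :=
  [set val (f x) | x : sub I & val x \in S].

Lemma mem_fimg S (x : sub I) : (val (f x) \in fimg S) = (val x \in S).
Proof.
apply/imsetP/idP => [[y + /val_inj /(bij_inj (bij_funP f)) ->]|xS].
  by rewrite inE.
by exists x; rewrite ?inE.
Qed.

Lemma fimg_sub S : fimg S \subset J.
Proof. by apply/subsetP => _ /imsetP[x _ ->]; exact: valP. Qed.

Lemma fimg_bij (S : {set X}) : S \subset I ->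
  exists g : bij (sub S) (sub (fimg S)), restricts f g.
Proof.
move=> sSI.
have im (x : sub S) : val (f (incl sSI x)) \in fimg S.
  by rewrite mem_fimg; exact: (valP x).
pose G (x : sub S) : sub (fimg S) := exist (fun y => y \in fimg S) _ (im x).
have gI : injective G.
  move=> x y [] /val_inj /(bij_inj (bij_funP f)).
  exact: incl_inj.
have gS (y : sub (fimg S)) : exists x, G x == y.
  case: y => y hy; have /imsetP[x + e] := hy; rewrite inE => xS.
  exists (exist (fun y => y \in S) (val x) xS); apply/eqP/val_inj => /=.
  by rewrite e; congr (val (f _)); exact: val_inj.
exists (Bij (bij_of_inj_surj gI gS)) => x y e /=.
by congr (val (f _)); exact: val_inj.
Qed.

Lemma fimg_decomp S T : decomp I S T -> decomp J (fimg S) (fimg T).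
Proof.
move=> /decompP[eI dST]; have [g [fK gK]] := bij_inv_ex f.
have memJ y : y \in J -> exists x : sub I, y = val (f x).
  by move=> yJ; exists (g (exist (fun y => y \in J) y yJ)); rewrite gK.
apply/decompP; split.
  apply/setP=> y; rewrite inE; apply/idP/idP => [/memJ[x ->]|].
    by rewrite !mem_fimg -in_setU -eI; exact: valP.
  by case/orP => /(subsetP (fimg_sub _)).
rewrite -setI_eq0; apply/eqP/setP => y; rewrite !inE; apply/negP => /andP[h1 h2].
have [x e] := memJ _ (subsetP (fimg_sub _) _ h1); move: h1 h2.
rewrite e !mem_fimg => h1 h2.
by have := disjointFr dST h1; rewrite h2.
Qed.

End Image.

Lemma fimgK (X Y : finType) (I : {set X}) (J : {set Y}) (f : bij (sub I) (sub J))
    (g : bij (sub J) (sub I)) (S : {set X}) :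
  cancel f g -> S \subset I -> fimg g (fimg f S) = S.
Proof.
move=> fK sSI; apply/setP => x; apply/idP/idP => [h|xS].
  have xI := subsetP (fimg_sub g _) _ h.
  by move: h; rewrite -[x]/(val (exist (fun y => y \in I) x xI : sub I)) -{1}[exist _ _ _]fK !mem_fimg.
have xI := subsetP sSI _ xS.
by rewrite -[x]/(val (exist (fun y => y \in I) x xI : sub I)) -[exist _ _ _]fK !mem_fimg.
Qed.

(** A bijection of [I] carries along every decomposition of [I]; this supplies
    the restrictions that the naturality axioms ask for. *)
Lemma transport_decomp (X Y : finType) (I S T : {set X}) (J : {set Y})
    (f : bij (sub I) (sub J)) (d : decomp I S T) :
  exists (d' : decomp J (fimg f S) (fimg f T)) (g : bij (sub S) (sub (fimg f S)))
    (h : bij (sub T) (sub (fimg f T))), restricts f g /\ restricts f h.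
Proof.
have [g hg] := fimg_bij f (decomp_subl d).
have [h hh] := fimg_bij f (decomp_subr d).
by exists (fimg_decomp f d), g, h.
Qed.

(** Both sides say that [I] is the disjoint union of [R], [S] and [T]. *)
Lemma decomp_triple (X : finType) (I R S T : {set X}) :
  decomp I (R :|: S) T && decomp (R :|: S) R S =
  decomp I R (S :|: T) && decomp (S :|: T) S T.
Proof.
rewrite /decomp !eqxx /= setUA -!andbA; congr (_ && _).
rewrite setIUl setIUr !setU_eq0.
by do 3!case: eqP.
Qed.

Lemma decomp_mem (X : finType) (I S T : {set X}) : decomp I S T ->
  forall z, (z \in I) = (z \in S) || (z \in T) /\ ~~ ((z \in S) && (z \in T)).
Proof.
move=> /decompP[-> d] z; rewrite inE; split => //; apply/negP => /andP[zS].
by rewrite (disjointFr d zS).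
Qed.

Lemma restricts_mem (X Y : finType) (I S T : {set X}) (I' S' T' : {set Y})
    (d : decomp I S T) (d' : decomp I' S' T') (f : bij (sub I) (sub I'))
    (g : bij (sub S) (sub S')) (h : bij (sub T) (sub T')) :
  restricts f g -> restricts f h -> forall x, (val (f x) \in S') = (val x \in S).
Proof.
move=> rg rh x; have [_] := decomp_mem d' (val (f x)).
have [xS|xS] := boolP (val x \in S).
  by rewrite (rg x (exist (fun z => z \in S) (val x) xS) erefl) (valP (g _)).
have [+ _] := decomp_mem d (val x); rewrite (valP x) (negbTE xS) /= => xT.
rewrite (rh x (exist (fun z => z \in T) (val x) (esym xT)) erefl) (valP (h _)).
by rewrite andbT => /negbTE.
Qed.

End Bijections.

(* Proves an equality of Boolean combinations of the blocks of a triple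
   decomposition by inspecting a point. *)
Ltac triple_set d1 d2 d3 d4 :=
  let z := fresh "z" in
  apply/setP => z; rewrite ?inE;
  move: (decomp_mem d1 z) (decomp_mem d2 z) (decomp_mem d3 z) (decomp_mem d4 z);
  do ?(case: (z \in _) => /=); by move=> [? ?] [? ?] [? ?] [? ?].

(** * Convolution *)

Lemma big_decomp (V : zmodType) (X : finType) (I : {set X})
    (F : {set X} * {set X} -> V) :
  \sum_(P | decomp I P.1 P.2) F P = \sum_(d : decomposition I) F (val d).
Proof.
rewrite (reindex_omap (val : decomposition I -> _) insub) => [|P dP]; last by rewrite insubT.
by apply: eq_bigl => d; rewrite (valP d) valK eqxx.
Qed.

Section Convolution.
Variables (K : fieldType) (b : species K) (m : monoid_ops b) (c : comonoid_ops b).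
Hypotheses (M : is_monoid m) (C : is_comonoid c).

Local Notation family := (forall A : finType, {linear b A -> b A}).
Implicit Types (f g h : family) (X Y : finType).

Definition natural f := forall (A B : finType) (s : bij A B) x,
  f B (sp_map b s x) = sp_map b s (f A x).

Definition conv_term f g X (I : {set X}) (x : b (sub I)) (d : decomposition I) :=
  mu m (valP d) (tmap (f _) (g _) (comu c (valP d) x)).

(** The summand of a convolution as a total function of the two parts, zero when
    they do not decompose [I]: sums over pairs of subsets can then be reindexed
    without dependent types. *)
Definition pair_term f g X (I S T : {set X}) (x : b (sub I)) : b (sub I) :=
  oapp (conv_term f g x) 0 (insub (S, T)).

Lemma pair_termE f g X (I S T : {set X}) (d : decomp I S T) x :
  pair_term f g S T x = mu m d (tmap (f _) (g _) (comu c d x)).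
Proof.
rewrite /pair_term (insubT (fun P => decomp I P.1 P.2) (d : decomp I (S, T).1 (S, T).2)) /=.
rewrite /conv_term; set e := valP _.
by have -> : e = d by exact: bool_irrelevance.
Qed.

Lemma convE f g X (I : {set X}) (x : b (sub I)) :
  conv m c f g x = \sum_(P : {set X} * {set X} | decomp I P.1 P.2) pair_term f g P.1 P.2 x.
Proof.
rewrite big_decomp; apply: eq_bigr => d _.
by rewrite (pair_termE _ _ (valP d)).
Qed.

Fact conv_linear f g X (I : {set X}) : linear (conv m c f g (I := I)).
Proof.
move=> a x y; rewrite /conv scaler_sumr -big_split; apply: eq_bigr => d _.
by rewrite !linearP.
Qed.

Lemma conv_natural f g : natural f -> natural g ->
  forall X Y (I : {set X}) (J : {set Y})
    (s : bij (sub I) (sub J)) (x : b (sub I)),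
  conv m c f g (sp_map b s x) = sp_map b s (conv m c f g x).
Proof.
move=> nf ng X Y I J s x; rewrite !convE linear_sum.
have [t [sK tK]] := bij_inv_ex s.
pose im (P : {set X} * {set X}) := (fimg s P.1, fimg s P.2).
pose im' (P : {set Y} * {set Y}) := (fimg t P.1, fimg t P.2).
have subs Z (L : {set Z}) P : decomp L P.1 P.2 -> P.1 \subset L /\ P.2 \subset L.
  by move=> d; split; [exact: decomp_subl d|exact: decomp_subr d].
rewrite (reindex_onto im im') => [|[S T] /subs /= [sS sT]]; last first.
  by rewrite /im /im' /= !(fimgK tK).
have dE (P : {set X} * {set X}) :
    decomp J (im P).1 (im P).2 && (im' (im P) == P) = decomp I P.1 P.2.
  case: P => S T; apply/andP/idP => [[/= d /eqP[eS eT]]|/= d].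
    by have := fimg_decomp t d; rewrite eS eT.
  have [/= sS sT] := subs _ _ (S, T) d.
  by rewrite /im' /= !(fimgK sK) // eqxx; split=> //; exact: fimg_decomp.
apply: eq_big => // -[S T]; rewrite dE /= => d.
have [d' [u [v [ru rv]]]] := transport_decomp s d.
rewrite (pair_termE _ _ d) (pair_termE _ _ d') (mu_natural M d d' ru rv).
rewrite (comu_natural C d d' ru rv); congr (mu _ _ _).
rewrite !tmap_comp; apply: eq_tmap => z /=; first exact: nf.
exact: ng.
Qed.

(** The convolution of two families as a family again, computed on the full
    subset of [A], so that convolutions can be iterated. *)
Definition convA_fun f g (A : finType) (x : b A) : b A :=
  sp_map b (setTbV A) (conv m c f g (sp_map b (setTb A) x)).

Fact convA_linear f g A : linear (@convA_fun f g A).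
Proof. by move=> a x y; rewrite /convA_fun linearP conv_linear linearP. Qed.

Definition convA f g (A : finType) : {linear b A -> b A} :=
  mklin (@convA_linear f g A).

Lemma convAE f g (A : finType) x :
  convA f g A x = sp_map b (setTbV A) (conv m c f g (sp_map b (setTb A) x)).
Proof. exact: mklinE. Qed.

Lemma convA_sub f g : natural f -> natural g ->
  forall X (I : {set X}) (x : b (sub I)), convA f g (sub I) x = conv m c f g x.
Proof.
move=> nf ng X I x; rewrite convAE (conv_natural nf ng).
by rewrite -sp_comp setTbK sp_id.
Qed.

Lemma convA_natural f g : natural f -> natural g -> natural (convA f g).
Proof.
move=> nf ng A B s x; rewrite !convAE -[sp_map b (setTb B) _]sp_comp.
have -> : bcomp (setTb B) s = bcomp (bcomp (setTb B) (bcomp s (setTbV A))) (setTb A).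
  exact: bij_eq.
rewrite sp_comp (conv_natural nf ng) -!sp_comp.
by congr (sp_map b _ _); exact: bij_eq.
Qed.

Lemma eq_conv f f' g g' X (I : {set X}) (x : b (sub I)) :
  (forall S : {set X}, S \subset I -> f (sub S) =1 f' (sub S)) ->
  (forall S : {set X}, S \subset I -> g (sub S) =1 g' (sub S)) ->
  conv m c f g x = conv m c f' g' x.
Proof.
move=> ef eg; apply: eq_bigr => d _; congr (mu _ _ _).
apply: eq_tmap => y.
  exact/ef/(decomp_subl (valP d)).
exact/eg/(decomp_subr (valP d)).
Qed.

(** Both sides are sums over the decompositions of [I] into three blocks, one
    indexed by pairs [((R | S, T), (R, S))] and the other by pairs
    [((R, S | T), (S, T))]; the summands agree by associativity and
    coassociativity. *)
Lemma convA_assoc f g h : natural f -> natural g -> natural h ->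
  forall X (I : {set X}) (x : b (sub I)),
  conv m c (convA f g) h x = conv m c f (convA g h) x.
Proof.
move=> nf ng nh X I x; rewrite !convE.
pose L (P Q : {set X} * {set X}) : b (sub I) :=
  oapp (fun d : decomposition I =>
    oapp (fun e : decomposition (val d).1 =>
      mu m (valP d) (tmap (mu m (valP e) \o (tmap (f _) (g _) \o comu c (valP e)))
                          (h _) (comu c (valP d) x))) 0 (insub Q)) 0 (insub P).
pose R (P Q : {set X} * {set X}) : b (sub I) :=
  oapp (fun d : decomposition I =>
    oapp (fun e : decomposition (val d).2 =>
      mu m (valP d) (tmap (f _) (mu m (valP e) \o (tmap (g _) (h _) \o comu c (valP e)))
                          (comu c (valP d) x))) 0 (insub Q)) 0 (insub P).
have LE U T A B (d : decomp I U T) (e : decomp U A B) : L (U, T) (A, B) =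
    mu m d (tmap (mu m e \o (tmap (f _) (g _) \o comu c e)) (h _) (comu c d x)).
  rewrite /L (insubT (fun P => decomp I P.1 P.2) (d : decomp I (U, T).1 (U, T).2)) /=.
  rewrite (insubT (fun P => decomp U P.1 P.2) (e : decomp U (A, B).1 (A, B).2)) /=.
  set d' := valP _; set e' := valP _.
  have -> : d' = d by exact: bool_irrelevance.
  by have -> : e' = e by exact: bool_irrelevance.
have RE U T A B (d : decomp I U T) (e : decomp T A B) : R (U, T) (A, B) =
    mu m d (tmap (f _) (mu m e \o (tmap (g _) (h _) \o comu c e)) (comu c d x)).
  rewrite /R (insubT (fun P => decomp I P.1 P.2) (d : decomp I (U, T).1 (U, T).2)) /=.
  rewrite (insubT (fun P => decomp T P.1 P.2) (e : decomp T (A, B).1 (A, B).2)) /=.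
  set d' := valP _; set e' := valP _.
  have -> : d' = d by exact: bool_irrelevance.
  by have -> : e' = e by exact: bool_irrelevance.
have eL P : decomp I P.1 P.2 -> pair_term (convA f g) h P.1 P.2 x =
    \sum_(Q | decomp P.1 Q.1 Q.2) L P Q.
  case: P => U T /= d; rewrite (pair_termE _ _ d) big_decomp.
  rewrite (eq_tmap (f' := mklin (conv_linear f g (I := U))) (g' := h (sub T))) //; last first.
    by move=> u; rewrite convA_sub // mklinE.
  transitivity (\sum_(e : decomposition U) mu m d (tmap (mu m (valP e) \o
    (tmap (f _) (g _) \o comu c (valP e))) (h (sub T)) (comu c d x))).
    move: (comu c d x) => t; elim/tensor_ind: t => [u v|u v hu hv].
      rewrite tmapE mklinE /conv tens_suml linear_sum; apply: eq_bigr => e _.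
      by rewrite tmapE.
    by rewrite !linearD hu hv -big_split; apply: eq_bigr => e _; rewrite !linearD.
  by apply: eq_bigr => e _; rewrite [in RHS](surjective_pairing (val e)) (LE _ _ _ _ d (valP e)).
have eR P : decomp I P.1 P.2 -> pair_term f (convA g h) P.1 P.2 x =
    \sum_(Q | decomp P.2 Q.1 Q.2) R P Q.
  case: P => U T /= d; rewrite (pair_termE _ _ d) big_decomp.
  rewrite (eq_tmap (f' := f (sub U)) (g' := mklin (conv_linear g h (I := T)))) //; last first.
    by move=> u; rewrite convA_sub // mklinE.
  transitivity (\sum_(e : decomposition T) mu m d (tmap (f (sub U)) (mu m (valP e) \o
    (tmap (g _) (h _) \o comu c (valP e))) (comu c d x))).
    move: (comu c d x) => t; elim/tensor_ind: t => [u v|u v hu hv].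
      rewrite tmapE mklinE /conv tens_sumr linear_sum; apply: eq_bigr => e _.
      by rewrite tmapE.
    by rewrite !linearD hu hv -big_split; apply: eq_bigr => e _; rewrite !linearD.
  by apply: eq_bigr => e _; rewrite [in RHS](surjective_pairing (val e)) (RE _ _ _ _ d (valP e)).
rewrite (eq_bigr _ eL) (eq_bigr _ eR) !pair_big_dep /=.
(* The change of indices from ((R, S | T), (S, T)) to ((R | S, T), (R, S)). *)
pose to (p : ({set X} * {set X}) * ({set X} * {set X})) :=
  ((p.1.1 :|: p.2.1, p.2.2), (p.1.1, p.2.1)).
pose from (p : ({set X} * {set X}) * ({set X} * {set X})) :=
  ((p.2.1, p.2.2 :|: p.1.2), (p.2.2, p.1.2)).
rewrite (reindex_onto to from) => [|[[U T] [R' S]] /andP[/= _ /decompP[-> _]] //].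
have toE p : (decomp I (to p).1.1 (to p).1.2 && decomp (to p).1.1 (to p).2.1 (to p).2.2)
    && (from (to p) == p) = decomp I p.1.1 p.1.2 && decomp p.1.2 p.2.1 p.2.2.
  case: p => [[A V] [S T]] /=.
  rewrite decomp_triple; apply/andP/andP => [[/andP[d1 d2] /eqP[<-]] //|[d1 d2]].
  have /decompP[eV _] := d2.
  by rewrite /from /= -eV eqxx d1.
apply: eq_big => // -[[A V] [S T]]; rewrite toE /to /= => /andP[d1 d2].
have /decompP[eV _] := d2; rewrite {}eV in d1 d2 *.
have := decomp_triple I A S T; rewrite d1 d2 => /andP[d3 d4].
rewrite (LE _ _ _ _ d3 d4) (RE _ _ _ _ d1 d2).
transitivity (mu m d3 (tmap (mu m d4) (idl _) (tmap (tmap (f _) (g _)) (h _)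
    (tmap (comu c d4) (idl _) (comu c d3 x))))).
  by rewrite !tmap_comp; congr (mu _ _ _); exact: eq_tmap.
rewrite (mu_assoc M d4 d3 d2 d1) tmap_assoc (comu_assoc C d4 d3 d2 d1).
by rewrite !tmap_comp; congr (mu _ _ _); exact: eq_tmap.
Qed.

End Convolution.

(** * The antipode of a connected bimonoid *)

Lemma card_sub (X : finType) (S : {set X}) : #|sub S| = #|S|.
Proof. exact: card_sig. Qed.

Section Connected.
Variables (K : fieldType) (b : species K) (m : monoid_ops b) (c : comonoid_ops b).
Hypotheses (M : is_monoid m) (C : is_comonoid c).
Hypothesis iota_epsK : forall y, iota m (eps c y) = y.

Lemma iota0_eps0K X (y : b (sub (set0 : {set X}))) : iota0 m X (eps0 c X y) = y.
Proof.
rewrite /= iota_epsK -sp_comp; set f := bcomp _ _.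
have -> : f = bid _ by apply: bij_eq => -[x hx]; have := hx; rewrite inE.
exact: sp_id.
Qed.

(** Connectedness leaves no choice for a component over the empty set: the
    counit axiom determines the coproduct. *)
Lemma comu0l (X : finType) (I : {set X}) (x : b (sub I)) :
  comu c (decomp0l I) x = tens (iota0 m X 1) x.
Proof.
have := congr1 (tmap (iota0 m X) (idl _)) (comu_unitl C x).
rewrite tmap_comp tunitlE tmapE => <-.
rewrite -[LHS]tmap_id; apply: eq_tmap => // y.
by rewrite /idl -[LHS]iota0_eps0K.
Qed.

Lemma comu0r (X : finType) (I : {set X}) (x : b (sub I)) :
  comu c (decomp0r I) x = tens x (iota0 m X 1).
Proof.
have := congr1 (tmap (idl _) (iota0 m X)) (comu_unitr C x).
rewrite tmap_comp tunitrE tmapE => <-.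
rewrite -[LHS]tmap_id; apply: eq_tmap => // y.
by rewrite /idl -[LHS]iota0_eps0K.
Qed.

Lemma mu0l (X : finType) (I : {set X}) (x : b (sub I)) :
  mu m (decomp0l I) (tens (iota0 m X 1) x) = x.
Proof. by have := mu_unitl M x; rewrite tunitlE tmapE. Qed.

Lemma mu0r (X : finType) (I : {set X}) (x : b (sub I)) :
  mu m (decomp0r I) (tens x (iota0 m X 1)) = x.
Proof. by have := mu_unitr M x; rewrite tunitrE tmapE. Qed.

Local Notation family := (forall A : finType, {linear b A -> b A}).
Implicit Types (f g h : family) (X Y : finType).

(** On an empty set the unit of convolution is [iota \o eps], which is the
    identity by connectedness. *)
Definition conv_unit : family := fun A => if #|A| == 0%N then idl (b A) else \0.

Lemma conv_unit_natural : natural conv_unit.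
Proof.
move=> A B s x; rewrite /conv_unit (bij_eq_card (bij_funP s)); case: ifP => // _.
by rewrite linear0.
Qed.

Lemma card_sub_eq0 X (S : {set X}) : (#|sub S| == 0%N) = (S == set0).
Proof. by rewrite card_sub cards_eq0. Qed.

Lemma conv_unitl f X (I : {set X}) (x : b (sub I)) : conv m c conv_unit f x = f _ x.
Proof.
rewrite convE (bigD1 (set0, I)) ?decomp0l //= big1 ?addr0 => [|[S T] /andP[/= d ST]].
  rewrite (pair_termE _ _ _ _ (decomp0l I)) comu0l tmapE /conv_unit.
  by rewrite card_sub_eq0 eqxx mu0l.
rewrite (pair_termE _ _ _ _ d) tmap0l ?linear0 // => y.
rewrite /conv_unit card_sub_eq0; case: eqP => // S0.
by case/negP: ST; have /decompP[-> _] := d; rewrite S0 set0U eqxx.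
Qed.

Lemma conv_unitr f X (I : {set X}) (x : b (sub I)) : conv m c f conv_unit x = f _ x.
Proof.
rewrite convE (bigD1 (I, set0)) ?decomp0r //= big1 ?addr0 => [|[S T] /andP[/= d ST]].
  rewrite (pair_termE _ _ _ _ (decomp0r I)) comu0r tmapE /conv_unit.
  by rewrite card_sub_eq0 eqxx mu0r.
rewrite (pair_termE _ _ _ _ d) tmap0r ?linear0 // => y.
rewrite /conv_unit card_sub_eq0; case: eqP => // T0.
by case/negP: ST; have /decompP[-> _] := d; rewrite T0 setU0 eqxx.
Qed.

(** With [w] the convolution unit minus [f], the right inverse of [f] is the
    Neumann series of [w].  As [w] vanishes on empty sets, its [n]-th power
    vanishes on sets with fewer than [n] elements, and the [n]-th partial sum is
    stable there. *)
Section RightInverse.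
Variable f : family.
Hypotheses (nf : natural f) (f0 : forall A : finType, #|A| = 0%N -> f A =1 id).

Let w : family := fun A => conv_unit A \- f A.

Let nw : natural w.
Proof. by move=> A B s x; rewrite /= conv_unit_natural nf linearB. Qed.

Let w0 (A : finType) : #|A| = 0%N -> w A =1 (fun=> 0).
Proof. by move=> A0 x; rewrite /= /conv_unit A0 eqxx f0 // subrr. Qed.

(** The term with [S] empty is zero, so only proper subsets [T] matter. *)
Lemma eq_convw g g' X (I : {set X}) (x : b (sub I)) :
  (forall T : {set X}, (#|T| < #|I|)%N -> g (sub T) =1 g' (sub T)) ->
  conv m c w g x = conv m c w g' x.
Proof.
move=> eg; apply: eq_bigr => -[[S T] /= d] _; set e := valP _.
have [S0|S0] := eqVneq S set0.
  by rewrite !tmap0l // => y; rewrite w0 // card_sub S0 cards0.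
congr (mu _ _ _); apply: eq_tmap => //; apply: eg.
have /decompP[-> dST] := d; rewrite cardsU disjoint_setI0 // cards0 subn0.
by rewrite -[X in (X < _)%N]add0n ltn_add2r card_gt0.
Qed.

(** The partial sum of the powers of [w] below [n], in Horner form. *)
Fixpoint neumann (n : nat) : family :=
  if n is n'.+1 then fun A => conv_unit A \+ convA m c w (neumann n') A
  else fun A => \0.

Let nn n : natural (neumann n).
Proof.
elim: n => [|n IH] A B s x /=; first by rewrite linear0.
by rewrite linearD conv_unit_natural (convA_natural M C nw IH).
Qed.

Let neumann_stable n (A : finType) : (#|A| < n)%N -> neumann n A =1 neumann n.+1 A.
Proof.
elim: n A => // n IH A An x /=; congr (_ + _); rewrite !convAE; congr (sp_map _ _ _).
apply: eq_convw => T TA; apply: IH.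
by rewrite card_sub; apply: leq_trans TA _; rewrite cardsT -ltnS.
Qed.

(** [neumann] is stable on [A] from the index [#|A|.+1] on. *)
Definition rinv : family := fun A => neumann #|A|.+1 A.

Let rinvE n (A : finType) : (#|A| < n)%N -> rinv A =1 neumann n A.
Proof.
elim: n => // n IH; rewrite ltnS leq_eqVlt => /orP[/eqP<- //|An] x.
by rewrite IH // neumann_stable.
Qed.

Lemma rinv_natural : natural rinv.
Proof. by move=> A B s x; rewrite /rinv -(bij_eq_card (bij_funP s)) nn. Qed.

Lemma rinv0 (A : finType) : #|A| = 0%N -> rinv A =1 id.
Proof.
move=> A0 x; rewrite /rinv A0 /= /conv_unit A0 eqxx convAE /conv big1 ?linear0 ?addr0 //.
by move=> d _; rewrite tmap0r ?linear0.
Qed.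

Lemma conv_rinv X (I : {set X}) (x : b (sub I)) : conv m c f rinv x = conv_unit _ x.
Proof.
have e1 : rinv _ x = conv_unit _ x + conv m c w rinv x.
  rewrite {1}/rinv /=; congr (_ + _); rewrite (convA_sub M C nw (@nn _)).
  apply: eq_convw => T TI y; rewrite (rinvE (n := #|sub I|)) //.
  by rewrite !card_sub.
have e2 : conv m c conv_unit rinv x = conv m c w rinv x + conv m c f rinv x.
  rewrite -big_split; apply: eq_bigr => d _ /=; rewrite -linearD; congr (mu _ _ _).
  move: (comu c _ x) => t; elim/tensor_ind: t => [u v|u v hu hv]; last first.
    by rewrite !linearD hu hv addrACA.
  by rewrite !tmapE -tensDl; congr (tens _ _); rewrite /w /= subrK.
by apply: (addrI (conv m c w rinv x)); rewrite -e2 conv_unitl e1 addrC.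
Qed.

End RightInverse.

(** The identity [i] has a right inverse [r], which again has a right inverse
    [r']; then [r' = (i * r) * r' = i * (r * r') = i], so [r] is a two-sided
    inverse. *)
Lemma antipode_exists : exists s : sp_morph b b, is_antipode m c s.
Proof.
pose i : family := fun A => idl (b A).
have ni : natural i by [].
pose r := rinv i; have nr : natural r by exact: rinv_natural.
have r0 (A : finType) : #|A| = 0%N -> r A =1 id by exact: rinv0.
pose r' := rinv r; have nr' : natural r' by exact: rinv_natural.
have ir X (I : {set X}) (x : b (sub I)) : conv m c i r x = conv_unit _ x.
  exact: conv_rinv.
have rr' X (I : {set X}) (x : b (sub I)) : conv m c r r' x = conv_unit _ x.
  exact: conv_rinv.
have r'i X (I : {set X}) (x : b (sub I)) : r' _ x = x.
  rewrite -[LHS]conv_unitl; transitivity (conv m c (convA m c i r) r' x).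
    by apply: eq_conv => // S _ y; rewrite convA_sub // ir.
  rewrite convA_assoc // -[RHS](conv_unitr i); apply: eq_conv => // S _ y.
  by rewrite convA_sub // rr'.
have ri X (I : {set X}) (x : b (sub I)) : conv m c r i x = conv_unit _ x.
  by rewrite -rr'; apply: eq_conv => // S _ y; rewrite r'i.
exists (SpMorph nr); split => [X x|X x|X I I0 x|X I I0 x].
- by rewrite ir /conv_unit card_sub_eq0 eqxx iota0_eps0K.
- by rewrite ri /conv_unit card_sub_eq0 eqxx iota0_eps0K.
- by rewrite ir /conv_unit card_sub_eq0 (negbTE I0).
- by rewrite ri /conv_unit card_sub_eq0 (negbTE I0).
Qed.

End Connected.

(** * Coproducts splitting the products *)

Section Split.
Variables (K : fieldType) (b : species K) (m : monoid_ops b) (c : comonoid_ops b).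

(** Cutting along [S] and [T] and gluing back. *)
Definition resplit (X : finType) (I S T : {set X}) (d : decomp I S T) (x : b (sub I)) :
  b (sub I) := mu m d (comu c d x).

Lemma resplitD (X : finType) (I S T : {set X}) (d : decomp I S T) :
  {morph resplit d : x y / x + y}.
Proof. by move=> x y; rewrite /resplit !linearD. Qed.

Lemma resplitB (X : finType) (I S T : {set X}) (d : decomp I S T) :
  {morph resplit d : x y / x - y}.
Proof. by move=> x y; rewrite /resplit !linearB. Qed.

Lemma resplitZ (X : finType) (I S T : {set X}) (d : decomp I S T) a x :
  resplit d (a *: x) = a *: resplit d x.
Proof. by rewrite /resplit !linZ. Qed.

Lemma resplit0 (X : finType) (I S T : {set X}) (d : decomp I S T) : resplit d 0 = 0.
Proof. by rewrite /resplit !linear0. Qed.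

(** What a coproduct knows about the product without meeting the braiding.  In
    [resplit_mul], [resplit_mur] and [resplitC] the two decompositions [R, S | T]
    and [R | S, T] of [I] are nested. *)
Record nested_split : Prop := NestedSplit {
  resplit_natural : forall (X Y : finType) (I S T : {set X}) (I' S' T' : {set Y})
    (d : decomp I S T) (d' : decomp I' S' T') (f : bij (sub I) (sub I'))
    (g : bij (sub S) (sub S')) (h : bij (sub T) (sub T')),
    restricts f g -> restricts f h -> forall x,
    sp_map b f (resplit d x) = resplit d' (sp_map b f x);
  comuK : forall (X : finType) (I S T : {set X}) (d : decomp I S T) x,
    comu c d (mu m d x) = x;
  resplit_mul : forall (X : finType) (I R S T RS ST : {set X})
    (dRS : decomp RS R S) (dRS_T : decomp I RS T)
    (dST : decomp ST S T) (dR_ST : decomp I R ST) x y,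
    resplit dR_ST (mu m dRS_T (tens x y)) = mu m dRS_T (tens (resplit dRS x) y);
  resplit_mur : forall (X : finType) (I R S T RS ST : {set X})
    (dRS : decomp RS R S) (dRS_T : decomp I RS T)
    (dST : decomp ST S T) (dR_ST : decomp I R ST) x y,
    resplit dRS_T (mu m dR_ST (tens x y)) = mu m dR_ST (tens x (resplit dST y));
  resplitC : forall (X : finType) (I R S T RS ST : {set X})
    (dRS : decomp RS R S) (dRS_T : decomp I RS T)
    (dST : decomp ST S T) (dR_ST : decomp I R ST) x,
    resplit dR_ST (resplit dRS_T x) = resplit dRS_T (resplit dR_ST x)
}.

(** The compatibility axiom with [q = 0] says this when neither of [S] and [S']
    contains the other: the two exchanged blocks are then nonempty. *)
Definition crossing_free : Prop :=
  forall (X : finType) (I S T S' T' : {set X}) (d : decomp I S T)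
    (d' : decomp I S' T') x,
  ~~ (S \subset S') -> ~~ (S' \subset S) -> resplit d' (mu m d x) = 0.

End Split.

Section ConnectedBimonoid.
Variables (K : fieldType) (q : K) (b : species K).
Variables (m : monoid_ops b) (c : comonoid_ops b).
Hypothesis B : is_bimonoid q m c.
Hypothesis iota_epsK : forall y, iota m (eps c y) = y.

Let M := bim_monoid B.
Let C := bim_comonoid B.
Let comul0 := comu0l C iota_epsK.
Let comur0 := comu0r C iota_epsK.

(** Lets an intersection be replaced by an equal set, such as [set0], inside the
    types. *)
Lemma bim_comu_mu_gen (X : finType) (I S T S' T' A A' D D' : {set X})
    (d : decomp I S T) (d' : decomp I S' T')
    (dS : decomp S A A') (dT : decomp T D D')
    (dS' : decomp S' A D) (dT' : decomp T' A' D') x :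
  A = S :&: S' -> A' = S :&: T' -> D = T :&: S' -> D' = T :&: T' ->
  comu c d' (mu m d x) =
  tmap (mu m dS') (mu m dT') (tmid _ _ (braiding q #|A'| #|D| _ _)
    (tmap (comu c dS) (comu c dT) x)).
Proof.
move=> e1 e2 e3 e4; move: dS dT dS' dT'; rewrite e1 e2 e3 e4 => dS dT dS' dT'.
rewrite (bim_comu_mu B d d').
have -> : decompAB d d' = dS by exact: bool_irrelevance.
have -> : decompCD d d' = dT by exact: bool_irrelevance.
have -> : decompAC d d' = dS' by exact: bool_irrelevance.
by have -> : decompBD d d' = dT' by exact: bool_irrelevance.
Qed.

(** For nested decompositions one of the two exchanged blocks is empty, so the
    braiding has exponent zero and the compatibility axiom holds without any
    power of [q], even if [q] is zero. *)
Lemma comu_mul (X : finType) (I R S T RS ST : {set X})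
    (dRS : decomp RS R S) (dRS_T : decomp I RS T)
    (dST : decomp ST S T) (dR_ST : decomp I R ST) x y :
  comu c dR_ST (mu m dRS_T (tens x y)) =
  tmap (idl _) (mu m dST) (tassoc _ _ _ (tens (comu c dRS x) y)).
Proof.
rewrite (bim_comu_mu_gen dRS_T dR_ST dRS (decomp0l T) (decomp0r R) dST).
- rewrite tmapE comul0; move: (comu c dRS x) => t; tind t => u v.
  by rewrite tmid_braidE cards0 muln0 expr0 scale1r !tmapE (mu0r M) tassocE tmapE.
all: by triple_set dRS dRS_T dST dR_ST.
Qed.

Lemma comu_mur (X : finType) (I R S T RS ST : {set X})
    (dRS : decomp RS R S) (dRS_T : decomp I RS T)
    (dST : decomp ST S T) (dR_ST : decomp I R ST) x y :
  comu c dRS_T (mu m dR_ST (tens x y)) =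
  tmap (mu m dRS) (idl _) (tassocV _ _ _ (tens x (comu c dST y))).
Proof.
rewrite (bim_comu_mu_gen dR_ST dRS_T (decomp0r R) dST dRS (decomp0l T)).
- rewrite tmapE comur0; move: (comu c dST y) => t; tind t => u v.
  by rewrite tmid_braidE cards0 mul0n expr0 scale1r !tmapE (mu0l M) tassocVE tmapE.
all: by triple_set dRS dRS_T dST dR_ST.
Qed.

Lemma comu_muK (X : finType) (I S T : {set X}) (d : decomp I S T) x :
  comu c d (mu m d x) = x.
Proof.
rewrite (bim_comu_mu_gen d d (decomp0r S) (decomp0l T) (decomp0r S) (decomp0l T)).
- tind x => u v; rewrite tmapE comur0 comul0 tmid_braidE cards0 mul0n expr0.
  by rewrite scale1r tmapE (mu0r M) (mu0l M).
all: by triple_set d d d d.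
Qed.

(** Every connected [q]-bimonoid satisfies the nested conditions, for any [q]:
    they are the compatibility axiom for nested decompositions, combined with
    associativity and coassociativity. *)
Lemma bimonoid_nested_split : nested_split m c.
Proof.
split.
- move=> X Y I S T I' S' T' d d' f g h rg rh x.
  by rewrite /resplit (mu_natural M d d' rg rh) (comu_natural C d d' rg rh).
- exact: comu_muK.
- move=> X I R S T RS ST dRS dRS_T dST dR_ST x y.
  rewrite /resplit (comu_mul dRS dRS_T dST).
  move: (comu c dRS x) => t; tind t => u v.
  have := mu_assoc M dRS dRS_T dST dR_ST (tens (tens u v) y).
  by rewrite !tassocE !tmapE.
- move=> X I R S T RS ST dRS dRS_T dST dR_ST x y.
  rewrite /resplit (comu_mur dRS dRS_T dST).
  move: (comu c dST y) => t; tind t => u v.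
  have := mu_assoc M dRS dRS_T dST dR_ST (tens (tens x u) v).
  by rewrite tassocVE tassocE !tmapE.
- move=> X I R S T RS ST dRS dRS_T dST dR_ST x.
  transitivity (mu m dRS_T (tmap (mu m dRS) (idl _) (tmap (comu c dRS) (idl _)
    (comu c dRS_T x)))).
    rewrite {1}/resplit /resplit; move: (comu c dRS_T x) => t; tind t => u v.
    rewrite (comu_mul dRS dRS_T dST) !tmapE; move: (comu c dRS u) => t; tind t => w z.
    have := mu_assoc M dRS dRS_T dST dR_ST (tens (tens w z) v).
    by rewrite !tassocE !tmapE.
  rewrite (mu_assoc M dRS dRS_T dST dR_ST) (comu_assoc C dRS dRS_T dST dR_ST).
  rewrite /resplit; move: (comu c dR_ST x) => t; tind t => u v.
  rewrite (comu_mur dRS dRS_T dST) !tmapE; move: (comu c dST v) => t; tind t => w z.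
  have := mu_assoc M dRS dRS_T dST dR_ST (tens (tens u w) z).
  by rewrite tassocVE !tassocE !tmapE.
Qed.

End ConnectedBimonoid.

Section SplitTransport.
Variables (K : fieldType) (a b : species K) (m : monoid_ops a) (n : monoid_ops b).
Variables (c : comonoid_ops b) (phi : sp_morph a b) (psi : sp_morph b a).
Hypotheses (Hphi : is_monoid_morph m n phi) (Hpsi : is_monoid_morph n m psi).
Hypotheses (phiK : forall A x, psi A (phi A x) = x).
Hypotheses (psiK : forall A x, phi A (psi A x) = x).

Definition transport_comonoid : comonoid_ops a :=
  @ComonoidOps K a
    (fun X I S T d => tmap (psi _) (psi _) \o (comu c d \o phi _)) (eps c \o phi _).

Lemma resplit_transport (X : finType) (I S T : {set X}) (d : decomp I S T) x :
  resplit m transport_comonoid d x = psi _ (resplit n c d (phi _ x)).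
Proof. by rewrite /resplit /= (morph_mu Hpsi). Qed.

Lemma transport_nested_split : nested_split n c -> nested_split m transport_comonoid.
Proof.
move=> G; split.
- move=> X Y I S T I' S' T' d d' f g h rg rh x.
  by rewrite !resplit_transport -sp_natural (resplit_natural G d d' rg rh) sp_natural.
- move=> X I S T d x; rewrite /= (morph_mu Hphi) (comuK G) tmap_comp -[RHS]tmap_id.
  by apply: eq_tmap => y /=; rewrite phiK.
- move=> X I R S T RS ST dRS dRS_T dST dR_ST x y.
  rewrite !resplit_transport (morph_mu Hphi) tmapE (resplit_mul G dRS dRS_T dST).
  by rewrite (morph_mu Hpsi) tmapE phiK.
- move=> X I R S T RS ST dRS dRS_T dST dR_ST x y.
  rewrite !resplit_transport (morph_mu Hphi) tmapE (resplit_mur G dRS dRS_T dST).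
  by rewrite (morph_mu Hpsi) tmapE phiK.
- move=> X I R S T RS ST dRS dRS_T dST dR_ST x.
  by rewrite !resplit_transport !psiK (resplitC G dRS dRS_T dST).
Qed.

Lemma transport_crossing_free : crossing_free n c -> crossing_free m transport_comonoid.
Proof.
move=> G X I S T S' T' d d' x h h'.
by rewrite resplit_transport (morph_mu Hphi) G // linear0.
Qed.

End SplitTransport.

Section HadamardSplit.
Variables (K : fieldType) (h k : species K).
Variables (mh : monoid_ops h) (mk : monoid_ops k).
Variables (ch : comonoid_ops h) (ck : comonoid_ops k).

Local Notation mhk := (hadamard_monoid mh mk).
Local Notation chk := (hadamard_comonoid ch ck).

Lemma tinterchangeK (U V W X : lmodType K) t :
  tinterchange U W V X (tinterchange U V W X t) = t.
Proof. by tind t => t1 t2; tind t1 => u v; tind t2 => w x; rewrite !tinterchangeE. Qed.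

Lemma had_resplitE (X : finType) (I S T : {set X}) (d : decomp I S T) x y :
  resplit mhk chk d (tens x y) = tens (resplit mh ch d x) (resplit mk ck d y).
Proof. by rewrite /resplit had_comu_tens had_muE tinterchangeK tmapE. Qed.

Lemma had_nested_split : nested_split mh ch -> nested_split mk ck -> nested_split mhk chk.
Proof.
move=> Gh Gk.
split.
- move=> X Y I S T I' S' T' d d' f g e rg re x.
  elim/tensor_ind: x => [u v|u v hu hv]; last by rewrite !(linearD, resplitD) hu hv.
  by rewrite had_mapE !had_resplitE had_mapE (resplit_natural Gh d d' rg re) (resplit_natural Gk d d' rg re).
- move=> X I S T d x; tind x => s t; tind s => u v; tind t => u' v'.
  by rewrite had_mu_tens had_comu_tens (comuK Gh) (comuK Gk) tinterchangeE.
- move=> X I R S T RS ST dRS dRS_T dST dR_ST x y.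
  elim/tensor_ind: x => [u v|u v hu hv]; last by rewrite !(resplitD, tensDl, linearD) hu hv.
  elim/tensor_ind: y => [u' v'|u' v' hu hv]; last by rewrite !(resplitD, tensDr, linearD) hu hv.
  rewrite had_mu_tens !had_resplitE had_mu_tens.
  by rewrite (resplit_mul Gh dRS dRS_T dST) (resplit_mul Gk dRS dRS_T dST).
- move=> X I R S T RS ST dRS dRS_T dST dR_ST x y.
  elim/tensor_ind: x => [u v|u v hu hv]; last by rewrite !(resplitD, tensDl, linearD) hu hv.
  elim/tensor_ind: y => [u' v'|u' v' hu hv]; last by rewrite !(resplitD, tensDr, linearD) hu hv.
  rewrite had_mu_tens !had_resplitE had_mu_tens.
  by rewrite (resplit_mur Gh dRS dRS_T dST) (resplit_mur Gk dRS dRS_T dST).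
- move=> X I R S T RS ST dRS dRS_T dST dR_ST x.
  elim/tensor_ind: x => [u v|u v hu hv]; last by rewrite !resplitD hu hv.
  by rewrite !had_resplitE (resplitC Gh dRS dRS_T dST) (resplitC Gk dRS dRS_T dST).
Qed.

(** It suffices that one of the two factors kills crossing products. *)
Lemma had_crossing_free : crossing_free mk ck -> crossing_free mhk chk.
Proof.
move=> Gk X I S T S' T' d d' x hS hS'.
elim/tensor_ind: x => [s t|u v hu hv]; last first.
  by rewrite linearD resplitD hu hv addr0.
elim/tensor_ind: s => [u v|u v hu hv]; last first.
  by rewrite tensDl linearD resplitD hu hv addr0.
elim/tensor_ind: t => [u' v'|u' v' hu hv]; last first.
  by rewrite tensDr linearD resplitD hu hv addr0.
by rewrite had_mu_tens had_resplitE Gk // tens0r.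
Qed.

End HadamardSplit.

(** * Primitive elements *)

Lemma decomp_nested (X : finType) (I S T S' T' : {set X}) :
  decomp I S T -> decomp I S' T' -> S \subset S' ->
  decomp S' S (T :&: S') /\ decomp T (T :&: S') T'.
Proof.
move=> d d' /subsetP sSS'; have mem z : z \in S -> z \in S' by exact: sSS'.
split; apply/andP; split; apply/eqP/setP => z; rewrite !inE;
move: (decomp_mem d z) (decomp_mem d' z) (mem z);
do ?(case: (z \in _) => /=);  by move=> [? ?] [? ?] // /(_ isT).
Qed.

Lemma decomp_card_lt (X : finType) (I S T : {set X}) :
  decomp I S T -> S != set0 -> T != set0 -> (#|S| < #|I|)%N /\ (#|T| < #|I|)%N.
Proof.
move=> /decompP[-> dST] S0 T0; rewrite cardsU disjoint_setI0 // cards0 subn0.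
by split; [rewrite -[X in (X < _)%N]addn0 ltn_add2l|rewrite -[X in (X < _)%N]add0n ltn_add2r];
  rewrite card_gt0.
Qed.

Lemma decomp_inj (X : finType) (I S T T' : {set X}) :
  decomp I S T -> decomp I S T' -> T = T'.
Proof.
move=> d d'; apply/setP => z; move: (decomp_mem d z) (decomp_mem d' z).
by do ?(case: (z \in _) => /=); move=> [? ?] [? ?].
Qed.

Section Primitive.
Variables (K : fieldType) (b : species K) (m : monoid_ops b) (c : comonoid_ops b).

(** Killing by [mu \o Delta] is the same as killing by [Delta] when the product is
    injective, and stays inside one space. *)
Definition proper_prim (X : finType) (I : {set X}) (x : b (sub I)) : Prop :=
  forall (S T : {set X}) (d : decomp I S T), S != set0 -> T != set0 -> resplit m c d x = 0.

Hypotheses (G : nested_split m c) (Z : crossing_free m c).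

Lemma resplitK (X : finType) (I S T : {set X}) (d : decomp I S T) x :
  resplit m c d (resplit m c d x) = resplit m c d x.
Proof. by rewrite {1 2}/resplit (comuK G). Qed.

(** Nested decompositions commute by hypothesis; for crossing ones both composites
    vanish. *)
Lemma resplit_comm (X : finType) (I S T S' T' : {set X}) (d : decomp I S T)
    (d' : decomp I S' T') x :
  resplit m c d (resplit m c d' x) = resplit m c d' (resplit m c d x).
Proof.
have [sS|nS] := boolP (S \subset S').
  by have [e e'] := decomp_nested d d' sS; rewrite (resplitC G e d' e' d).
have [sS|nS'] := boolP (S' \subset S).
  by have [e e'] := decomp_nested d' d sS; rewrite (resplitC G e d e' d').
by rewrite {2}/resplit Z // {2}/resplit Z.
Qed.

Lemma resplit_comp0 (X : finType) (I S T : {set X}) (d : decomp I S T) (x : b (sub I)) :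
  resplit m c d (x - resplit m c d x) = 0.
Proof. by rewrite resplitB resplitK subrr. Qed.

(** Every element is a primitive one plus a sum of products: with [e] one of the
    commuting idempotents, [x = (x - e x) + e x], where [e x] is a sum of products
    and [x - e x] is killed by [e] and by every idempotent that killed [x]. *)
Lemma prod_ind (X : finType) (I : {set X}) (Q : b (sub I) -> Prop) :
  (forall x y, Q x -> Q y -> Q (x + y)) ->
  (forall x, proper_prim x -> Q x) ->
  (forall (S T : {set X}) (d : decomp I S T) y z,
     S != set0 -> T != set0 -> Q (mu m d (tens y z))) ->
  forall x, Q x.
Proof.
move=> QD Qprim Qmu.
pose proper (d : decomposition I) := ((val d).1 != set0) && ((val d).2 != set0).
have Qresplit d x : proper d -> Q (resplit m c (valP d) x).
  rewrite /resplit => /andP[S0 T0]; move: (comu c (valP d) x) => t.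
  elim/tensor_ind: t => [u v|u v hu hv]; first exact: Qmu.
  by rewrite linearD; exact: QD.
(* Elements killed by the idempotents of a list l satisfy Q; l shrinks to nil. *)
suff H (l : seq (decomposition I)) :
    (forall x, (forall d, d \in l -> proper d -> resplit m c (valP d) x = 0) -> Q x) ->
    forall x, Q x.
  apply: (H (enum (decomposition I))) => x hx; apply: Qprim => S T d S0 T0.
  have := hx (exist (fun P => decomp I P.1 P.2) (S, T) d); rewrite mem_enum.
  set e := valP _; have -> : e = d by exact: bool_irrelevance.
  by apply; rewrite /proper /= ?S0.
elim: l => [|d l IH] H x; first exact: H.
apply: IH x => x hx; have [pd|npd] := boolP (proper d); last first.
  by apply: H => e; rewrite inE => /orP[/eqP->|el] pe; [rewrite pe in npd|exact: hx].
rewrite -[x](subrK (resplit m c (valP d) x)); apply: QD; last exact: Qresplit.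
apply: H => e; rewrite inE => /orP[/eqP->|el] pe; first exact: resplit_comp0.
by rewrite resplitB resplit_comm !hx // resplit0 subr0.
Qed.
End Primitive.

Section Comparison.
Variables (K : fieldType) (t b : species K).
Variables (mt : monoid_ops t) (mb : monoid_ops b).
Variables (ct : comonoid_ops t) (cb : comonoid_ops b).
Hypotheses (Gt : nested_split mt ct) (Zt : crossing_free mt ct).
Hypotheses (Gb : nested_split mb cb) (Zb : crossing_free mb cb).
Variable psi : sp_morph t b.
Hypothesis Hpsi : is_monoid_morph mt mb psi.
Hypothesis prim_psi : forall (X : finType) (I : {set X}) (x : t (sub I)),
  I != set0 -> proper_prim mt ct x -> proper_prim mb cb (psi _ x).

(** By [prod_ind] only primitive elements and products matter.  On a product, both
    sides reduce to the same identity over a smaller set. *)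
Lemma psi_resplit (X : finType) (I S T : {set X}) (d : decomp I S T) x :
  S != set0 -> T != set0 -> psi _ (resplit mt ct d x) = resplit mb cb d (psi _ x).
Proof.
have [n] := ubnP #|I|; elim: n I S T d x => // n IH I S T d x In S0 T0.
have I0 : I != set0.
  have [SI _] := decomp_card_lt d S0 T0; rewrite -card_gt0; exact: leq_trans SI.
elim/(prod_ind Gt Zt): x => [x y hx hy|x hx|S' T' d' y z S'0 T'0].
- by rewrite resplitD !linearD resplitD hx hy.
- by rewrite hx // linear0 prim_psi.
have [S'I T'I] := decomp_card_lt d' S'0 T'0; rewrite ltnS in In.
have IHS := IH S' _ _ _ _ (leq_trans S'I In).
have IHT := IH T' _ _ _ _ (leq_trans T'I In).
have [eS|SS'] := eqVneq S S'.
  subst S'; have eT := decomp_inj d' d; subst T'.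
  have -> : d' = d by exact: bool_irrelevance.
  by rewrite {1}/resplit (comuK Gt) (morph_mu Hpsi) /resplit (comuK Gb).
have [sS|nS] := boolP (S \subset S').
  have [e e'] := decomp_nested d d' sS.
  rewrite (resplit_mul Gt e d' e' d) !(morph_mu Hpsi) !tmapE (resplit_mul Gb e d' e' d).
  rewrite IHS //; apply: contra SS' => /eqP e0; rewrite eqEsubset sS /=.
  by have /decompP[-> _] := e; rewrite e0 setU0.
have [sS|nS'] := boolP (S' \subset S).
  have [e e'] := decomp_nested d' d sS.
  rewrite (resplit_mur Gt e d e' d') !(morph_mu Hpsi) !tmapE (resplit_mur Gb e d e' d').
  rewrite IHT //; apply: contra SS' => /eqP e0; rewrite eqEsubset sS andbT.
  by have /decompP[-> _] := e; rewrite e0 setU0.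
by rewrite Zt // linear0 (morph_mu Hpsi) Zb.
Qed.

Hypothesis prim_inj : forall (X : finType) (I : {set X}) (x : t (sub I)),
  I != set0 -> proper_prim mt ct x -> psi _ x = 0 -> x = 0.
Hypothesis prim_surj : forall (X : finType) (I : {set X}) (y : b (sub I)),
  I != set0 -> proper_prim mb cb y -> exists x, psi _ x = y.
Hypothesis psi0 : forall (X : finType), bijective (psi (sub (set0 : {set X}))).

Lemma lin_inv (V W : lmodType K) (f : {linear V -> W}) :
  bijective f -> exists2 g : {linear W -> V}, cancel f g & cancel g f.
Proof.
move=> [g fK gK]; have gl : linear g by exact: can2_linear fK gK.
by exists (mklin gl) => x; rewrite mklinE.
Qed.

Lemma bij_of_lin (V W : lmodType K) (f : {linear V -> W}) :
  (forall x, f x = 0 -> x = 0) -> (forall y, exists x, f x = y) -> bijective f.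
Proof.
move=> f0 fS.
have fI : injective f.
  by move=> x y e; apply/eqP; rewrite -subr_eq0; apply/eqP/f0; rewrite linearB e subrr.
exists (fun y => sval (cid (fS y))) => [x|y]; last by case: cid.
by apply: fI; case: cid.
Qed.

(** If [psi x = 0], then [psi (x) psi] kills [Delta x], because [psi] commutes with
    [mu \o Delta] and the product of [b] is injective.  By induction [psi (x) psi]
    is invertible on proper parts, so [x] is primitive. *)
Lemma comparison_sub (X : finType) (I : {set X}) : bijective (psi (sub I)).
Proof.
have [n] := ubnP #|I|; elim: n I => // n IH I; rewrite ltnS => In.
have [->|I0] := eqVneq I set0; first exact: psi0.
apply: bij_of_lin => [x x0|].
  apply: prim_inj => // S T d S0 T0; rewrite /resplit.
  have [SI TI] := decomp_card_lt d S0 T0.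
  have [f fK _] := lin_inv (IH _ (leq_trans SI In)).
  have [g gK _] := lin_inv (IH _ (leq_trans TI In)).
  have e : tmap (psi _) (psi _) (comu ct d x) = 0.
    rewrite -[LHS](comuK Gb d) -(morph_mu Hpsi) -[mu mt d _]/(resplit mt ct d x).
    by rewrite psi_resplit // x0 resplit0 linear0.
  rewrite -[comu ct d x]tmap_id.
  have -> : tmap (idl _) (idl _) (comu ct d x) =
      tmap f g (tmap (psi _) (psi _) (comu ct d x)).
    by rewrite tmap_comp; apply: eq_tmap => y /=; rewrite ?fK ?gK.
  by rewrite e !linear0.
elim/(prod_ind Gb Zb) => [x y [u <-] [v <-]|y hy|S T d y z S0 T0].
- by exists (u + v); rewrite linearD.
- exact: prim_surj.
have [SI TI] := decomp_card_lt d S0 T0.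
have [f _ fK] := lin_inv (IH _ (leq_trans SI In)).
have [g _ gK] := lin_inv (IH _ (leq_trans TI In)).
by exists (mu mt d (tens (f y) (g z))); rewrite (morph_mu Hpsi) tmapE fK gK.
Qed.

Lemma comparison_bij (A : finType) : bijective (psi A).
Proof.
have [f fK gK] := comparison_sub [set: A].
have tK (p : species K) : cancel (sp_map p (setTb A)) (sp_map p (setTbV A)).
  by move=> x; rewrite -sp_comp setTbK sp_id.
have tVK (p : species K) : cancel (sp_map p (setTbV A)) (sp_map p (setTb A)).
  by move=> x; rewrite -sp_comp setTbVK sp_id.
exists (fun y => sp_map t (setTbV A) (f (sp_map b (setTb A) y))) => x.
  by rewrite -sp_natural fK tK.
by rewrite sp_natural gK tK.
Qed.

End Comparison.

Lemma monoid_iso_of_bij (K : fieldType) (t b : species K) (mt : monoid_ops t)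
    (mb : monoid_ops b) (psi : sp_morph t b) :
  is_monoid_morph mt mb psi -> (forall A, bijective (psi A)) -> monoid_iso mb mt.
Proof.
move=> Hpsi Bpsi.
have inv A : exists g : {linear b A -> t A}, cancel (psi A) g /\ cancel g (psi A).
  by have [g fK gK] := lin_inv (Bpsi A); exists g.
pose phi A := sval (cid (inv A)).
have phiK A : cancel (psi A) (phi A) by case: (svalP (cid (inv A))).
have psiK A : cancel (phi A) (psi A) by case: (svalP (cid (inv A))).
have nphi (A B : finType) (f : bij A B) x : phi B (sp_map b f x) = sp_map t f (phi A x).
  by rewrite -{1}[x]psiK -sp_natural phiK.
exists (SpMorph nphi), psi; split => //; split => [X I S T d x|a] /=.
  rewrite -{1}[x]tmap_id (_ : tmap (idl _) (idl _) x =
    tmap (psi _) (psi _) (tmap (phi _) (phi _) x)) -?(morph_mu Hpsi) ?phiK //.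
  by rewrite tmap_comp; apply: eq_tmap => y /=; rewrite psiK.
by rewrite -(morph_iota Hpsi) phiK.
Qed.

(** * Compositions passing through a subset *)

Section Passing.
Variable A : finType.
Implicit Types (a : {set A}) (H L : seq {set A}).

Definition below a H := all (fun C : {set A} => C \subset a) H.
Definition away a H := all (fun C : {set A} => [disjoint C & a]) H.

(** The composition [H] passes through [a] when an initial segment of its blocks
    lies inside [a] and all the later blocks lie outside. *)
Fixpoint passes a H : bool :=
  if H is C :: H' then if C \subset a then passes a H' else away a H else true.

Lemma belowS a a' H : a \subset a' -> below a H -> below a' H.
Proof. by move=> aa'; apply: sub_all => C /subset_trans; exact. Qed.

Lemma passes_away a H : away a H -> passes a H.
Proof. elim: H => // C H IH aCH; have /andP[_ aH] := aCH.
by rewrite /= (IH aH); case: ifP. Qed.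

Lemma passes_catl a L1 L2 : away a L2 -> passes a (L1 ++ L2) = passes a L1.
Proof.
move=> a2; elim: L1 => [|C L1 IH] /=; first exact: passes_away.
by rewrite IH [away a (L1 ++ L2)]all_cat -/(away a L2) a2 andbT.
Qed.

Lemma passes_catr a L1 L2 : below a L1 -> passes a (L1 ++ L2) = passes a L2.
Proof. by elim: L1 => //= C L1 IH /andP[-> /IH]. Qed.

(** As soon as one block is not below [a], all later blocks must avoid [a]. *)
Lemma passes_cat_inv a L1 L2 : passes a (L1 ++ L2) -> below a L1 \/ away a L2.
Proof.
elim: L1 => [|C L1 IH] /=; first by left.
case: ifP => [_ /IH[h|h]|_ /andP[_]]; [by left|by right|right].
by move: b; rewrite [away a (L1 ++ L2)]all_cat => /andP[].
Qed.

Lemma passes_split a H : passes a H -> exists L1 L2, [/\ H = L1 ++ L2, below a L1 & away a L2].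
Proof.
elim: H => [|C H IH] /=; first by exists [::], [::].
case: ifP => [Ca /IH[L1 [L2 [-> b1 a2]]]|_ aH].
  by exists (C :: L1), L2; split => //=; rewrite Ca.
by exists [::], (C :: H); split.
Qed.

Lemma compn_mem (F : compn A) x : exists2 C, C \in cseq F & x \in C.
Proof.
have /and3P[_ _ /eqP/setP/(_ x)] := cseqP F.
by rewrite inE bigcup_seq => /bigcupP[C CF xC]; exists C.
Qed.

End Passing.

Lemma imset_away (A B : finType) (i : A -> B) (a : {set B}) (H : seq {set A}) :
  away a [seq i @: C | C : {set A} <- H] = away (i @^-1: a) H.
Proof.
rewrite /away all_map; apply: eq_all => C /=.
by rewrite !disjoints_subset sub_imset_pre preimsetC.
Qed.

Lemma imset_passes (A B : finType) (i : A -> B) (a : {set B}) (H : seq {set A}) :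
  passes a [seq i @: C | C : {set A} <- H] = passes (i @^-1: a) H.
Proof.
elim: H => [|C H IH] //.
have := imset_away i a (C :: H).
by rewrite /= sub_imset_pre IH => ->.
Qed.

(** * Deconcatenation on the free monoid *)

Section CtenInverse.
Variables (K : fieldType) (q : species K).

Lemma bij_invP (A B : finType) (f : bij A B) :
  {g : bij B A | cancel f g /\ cancel g f}.
Proof. by apply: cid; exact: bij_inv_ex. Qed.

Definition binv (A B : finType) (f : bij A B) : bij B A := sval (bij_invP f).

Lemma sp_mapK (A B : finType) (f : bij A B) :
  cancel (sp_map q f) (sp_map q (binv f)).
Proof.
move=> x; rewrite -sp_comp; have [fK _] := svalP (bij_invP f).
by rewrite (_ : bcomp _ _ = bid A) ?sp_id //; apply: bij_eq.
Qed.

Lemma sp_mapVK (A B : finType) (f : bij A B) :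
  cancel (sp_map q (binv f)) (sp_map q f).
Proof.
move=> x; rewrite -sp_comp; have [_ fK] := svalP (bij_invP f).
by rewrite (_ : bcomp _ _ = bid B) ?sp_id //; apply: bij_eq.
Qed.

(** [cmapV] and [ccatV] are the inverses of [cmap] and [ccat]. *)
Fixpoint cmapV (A B : finType) (i : A -> B) (hi : injective i) (F : seq {set A}) :
    {linear cten q [seq i @: C | C : {set A} <- F] -> cten q F} :=
  match F return {linear cten q [seq i @: C | C : {set A} <- F] -> cten q F} with
  | [::] => idl K^o
  | C :: F' => tmap (sp_map q (binv (imb hi C))) (cmapV hi F')
  end.

Lemma cmapK (A B : finType) (i : A -> B) (hi : injective i) (F : seq {set A}) :
  cancel (cmap q hi F) (cmapV hi F).
Proof.
elim: F => [|C F IH] //= t; rewrite tmap_comp -[RHS]tmap_id.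
by apply: eq_tmap => x /=; rewrite ?IH ?sp_mapK.
Qed.

Lemma cmapVK (A B : finType) (i : A -> B) (hi : injective i) (F : seq {set A}) :
  cancel (cmapV hi F) (cmap q hi F).
Proof.
elim: F => [|C F IH] //= t; rewrite tmap_comp -[RHS]tmap_id.
by apply: eq_tmap => x /=; rewrite ?IH ?sp_mapVK.
Qed.

Fixpoint ccatV (A : finType) (F G : seq {set A}) :
    {linear cten q (F ++ G) -> tensor (cten q F) (cten q G)} :=
  match F return {linear cten q (F ++ G) -> tensor (cten q F) (cten q G)} with
  | [::] => tunitl (cten q G)
  | C :: F' => tassocV _ _ _ \o tmap (idl (q (sub C))) (ccatV F' G)
  end.

Lemma ccatK (A : finType) (F G : seq {set A}) : cancel (ccat q F G) (ccatV F G).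
Proof.
elim: F => [|C F IH] t.
  by tind t => a v; rewrite /= tliftE tunitlE tensZr -tensZl; congr tens; exact: mulr1.
rewrite /=; tind t => u w; tind u => u v.
rewrite tassocE tmapE; rewrite tmapE IH.
by rewrite tassocVE.
Qed.

Lemma ccatVK (A : finType) (F G : seq {set A}) : cancel (ccatV F G) (ccat q F G).
Proof.
elim: F => [|C F IH] t; first by rewrite /= tunitlE tliftE scale1r.
rewrite /=; tind t => u w; rewrite tmapE -{2}[w]IH.
move: (ccatV F G w) => t; tind t => v z.
by rewrite tassocVE tassocE tmapE.
Qed.

End CtenInverse.

Section FreeSplit.
Variables (K : fieldType) (q : species K).
Local Notation tq := (free_species q).
Local Notation mtq := (free_monoid q).

Lemma free_ind (A : finType) (P : free_obj q A -> Prop) :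
  P 0 -> (forall x y, P x -> P y -> P (x + y)) ->
  (forall (F : compn A) v, P (cinj q F v)) -> forall x, P x.
Proof. by move=> P0 PD Pc x; rewrite (cinj_sum x); elim/big_ind: _. Qed.

Lemma cinj_at (A : finType) (F : compn A) v : (cinj q F v : free_obj q A) F = v.
Proof. by rewrite /cinj mklinE ffunE dfwith_in. Qed.

Lemma cinj_at0 (A : finType) (F G : compn A) v :
  F != G -> (cinj q F v : free_obj q A) G = 0.
Proof. by move=> FG; rewrite /cinj mklinE ffunE dfwith_out. Qed.

Definition trace_in (X : finType) (I S : {set X}) : {set sub I} :=
  [set x | val x \in S].

Section Decomp.
Variables (X : finType) (I S T : {set X}) (d : decomp I S T).
Let iS := incl (decomp_subl d).
Let iT := incl (decomp_subr d).

Lemma inclS_below (F : seq {set sub S}) :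
  below (trace_in I S) [seq iS @: C | C : {set sub S} <- F].
Proof.
apply/allP => _ /mapP[C _ ->]; apply/subsetP => _ /imsetP[x _ ->].
by rewrite inE; exact: (valP x).
Qed.

Lemma inclT_away (U : {set X}) (G : seq {set sub T}) : [disjoint T & U] ->
  away (trace_in I U) [seq iT @: C | C : {set sub T} <- G].
Proof.
move=> TU; apply/allP => _ /mapP[C _ ->]; rewrite disjoints_subset.
apply/subsetP => _ /imsetP[x _ ->]; rewrite !inE.
by rewrite (disjointFr TU (valP x)).
Qed.

(** [F] is recovered from [F . G] as the sequence of the blocks inside [S]. *)
Lemma concat_inj (F F' : compn (sub S)) (G G' : compn (sub T)) :
  compn_concat d F G = compn_concat d F' G' -> F = F' /\ G = G'.
Proof.
move=> /(congr1 (@cseq _)) /= e.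
have fE (H : compn (sub S)) (L : compn (sub T)) :
  [seq C : {set sub I} <- [seq iS @: C | C : {set sub S} <- H] ++
    [seq iT @: C | C : {set sub T} <- L] | C \subset trace_in I S] =
    [seq iS @: C | C : {set sub S} <- H].
  rewrite filter_cat (all_filterP (inclS_below H)) -[RHS]cats0; congr (_ ++ _).
  apply/eqP; rewrite -size_eq0 size_filter -leqn0 leqNgt -has_count; apply/hasPn => C CL.
  have dST : [disjoint T & S] by have /decompP[_] := d; rewrite disjoint_sym.
  have := allP (inclT_away L dST) C CL; apply: contraL => /subsetP CS.
  have C0 : C != set0.
    move: CL => /mapP[D DL ->]; rewrite imset_eq0; apply/negP => /eqP D0.
    by have /and3P[+ _ _] := cseqP L; rewrite -D0 DL.
  have [z zC] := set0Pn _ C0; rewrite -setI_eq0; apply/set0Pn; exists z.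
  by rewrite inE zC CS.
have eF := congr1 (filter (fun C : {set sub I} => C \subset trace_in I S)) e.
rewrite !fE in eF; move: e; rewrite eF => /eqP; rewrite eqseq_cat // eqxx => /eqP eG.
by split; apply: val_inj => /=; [move: eF|move: eG]; apply: inj_map;
  apply: imset_inj; exact: incl_inj.
Qed.

Lemma concat_passes (F : compn (sub S)) (G : compn (sub T)) :
  passes (trace_in I S) (compn_concat d F G).
Proof.
rewrite passes_catr ?inclS_below // passes_away // inclT_away //.
by have /decompP[_] := d; rewrite disjoint_sym.
Qed.

(** The blocks inside [S] and those inside [T], pulled back to [S] and [T], are
    the two compositions. *)
Lemma passes_concat (H : compn (sub I)) :
  passes (trace_in I S) H -> exists F G, H = compn_concat d F G.
Proof.
move=> pH; have [L1 [L2 [eH b1 a2]]] := passes_split pH.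
have /decompP[eI dST] := d.
have [hH dH /eqP uH] := and3P (cseqP H).
pose F := [seq iS @^-1: C | C : {set sub I} <- L1].
pose G := [seq iT @^-1: C | C : {set sub I} <- L2].
have traceT x : (x \in trace_in I S) = (val x \notin T).
  have := decomp_mem d (val x); rewrite inE (valP x) => -[].
  by case: (_ \in S); case: (_ \in T).
have eF : [seq iS @: C | C : {set sub S} <- F] = L1.
  rewrite -map_comp -[RHS]map_id; apply/eq_in_map => C CL /=.
  apply/setP => x; apply/imsetP/idP => [[y + ->]|xC]; first by rewrite inE.
  have := subsetP (allP b1 _ CL) _ xC; rewrite inE => xS.
  exists (exist (fun z => z \in S) (val x) xS); last exact: val_inj.
  by rewrite inE (_ : iS _ = x) //; exact: val_inj.
have eG : [seq iT @: C | C : {set sub T} <- G] = L2.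
  rewrite -map_comp -[RHS]map_id; apply/eq_in_map => C CL /=.
  apply/setP => x; apply/imsetP/idP => [[y + ->]|xC]; first by rewrite inE.
  have := disjointFr (allP a2 _ CL) xC; rewrite traceT => /negbFE xT.
  exists (exist (fun z => z \in T) (val x) xT); last exact: val_inj.
  by rewrite inE (_ : iT _ = x) //; exact: val_inj.
have mem_union (x : sub I) : exists2 C, C \in L1 ++ L2 & x \in C.
  have : x \in \bigcup_(C <- L1 ++ L2) C by rewrite -eH uH inE.
  by rewrite bigcup_seq => /bigcupP[C CL xC]; exists C.
have cF : is_compn F.
  apply/and3P; split.
  - apply/negP => /(map_f (fun C : {set sub S} => iS @: C)); rewrite eF imset0 => h0.
    by case/negP: hH; rewrite eH mem_cat h0.
  - move: dH; rewrite eH pairwise_cat => /and3P[_ + _]; rewrite -eF pairwise_map.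
    apply: sub_pairwise => C D /=; rewrite -!setI_eq0 -imsetI ?imset_eq0 // => x y _ _.
    exact: incl_inj.
  - apply/eqP/setP => x; rewrite in_setT bigcup_seq; apply/bigcupP.
    have [C] := mem_union (iS x); rewrite mem_cat => /orP[CL|CL] xC.
      by exists (iS @^-1: C); [exact: map_f|rewrite inE].
    have := disjointFr (allP a2 _ CL) xC; rewrite inE.
    by rewrite (valP x).
have cG : is_compn G.
  apply/and3P; split.
  - apply/negP => /(map_f (fun C : {set sub T} => iT @: C)); rewrite eG imset0 => h0.
    by case/negP: hH; rewrite eH mem_cat h0 orbT.
  - move: dH; rewrite eH pairwise_cat => /and3P[_ _]; rewrite -eG pairwise_map.
    apply: sub_pairwise => C D /=; rewrite -!setI_eq0 -imsetI ?imset_eq0 // => x y _ _.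
    exact: incl_inj.
  - apply/eqP/setP => x; rewrite in_setT bigcup_seq; apply/bigcupP.
    have [C] := mem_union (iT x); rewrite mem_cat => /orP[CL|CL] xC.
      have := subsetP (allP b1 _ CL) _ xC; rewrite traceT.
      by rewrite (valP x).
    by exists (iT @^-1: C); [exact: map_f|rewrite inE].
exists (Compn cF), (Compn cG); apply: val_inj.
by rewrite /= -[X in X ++ _]/([seq iS @: C | C : {set sub S} <- F])
  -[X in _ ++ X]/([seq iT @: C | C : {set sub T} <- G]) eF eG.
Qed.

End Decomp.
End FreeSplit.

Section FreeComonoid.
Variables (K : fieldType) (q : species K).
Local Notation tq := (free_species q).
Local Notation mtq := (free_monoid q).

Section Deconcatenation.
Variables (X : finType) (I S T : {set X}) (d : decomp I S T).

(** Reading off the component of [x] at each concatenation [F . G] avoids having to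
    cut a given composition, or even to decide whether it can be cut. *)
Definition deconcat_fun (x : free_obj q (sub I)) :
    tensor (free_obj q (sub S)) (free_obj q (sub T)) :=
  \sum_(F : compn (sub S)) \sum_(G : compn (sub T))
    tmap (cinj q F \o cmapV q (@incl_inj _ _ _ (decomp_subl d)) F)
         (cinj q G \o cmapV q (@incl_inj _ _ _ (decomp_subr d)) G)
      (ccatV q _ _ (x (compn_concat d F G))).

Fact deconcat_linear : linear deconcat_fun.
Proof.
move=> a x y; rewrite /deconcat_fun scaler_sumr -big_split; apply: eq_bigr => F _.
rewrite scaler_sumr -big_split; apply: eq_bigr => G _ /=.
by rewrite ffunE [X in X + _]ffunE !linearP.
Qed.

Definition deconcat := mklin deconcat_linear.

Lemma deconcatE (F : compn (sub S)) (G : compn (sub T)) w :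
  deconcat (cinj q (compn_concat d F G) w) =
  tmap (cinj q F \o cmapV q (@incl_inj _ _ _ (decomp_subl d)) F)
       (cinj q G \o cmapV q (@incl_inj _ _ _ (decomp_subr d)) G) (ccatV q _ _ w).
Proof.
rewrite mklinE /deconcat_fun (bigD1 F) //= (bigD1 G) //= cinj_at.
rewrite !big1 ?addr0 // => [F' FF'|G' GG'].
  rewrite big1 // => G' _; rewrite cinj_at0 ?linear0 //.
  by apply: contra FF' => /eqP /concat_inj[->].
rewrite cinj_at0 ?linear0 //.
by apply: contra GG' => /eqP /concat_inj[_ ->].
Qed.

Lemma deconcat0 (H : compn (sub I)) w :
  ~~ passes (trace_in I S) H -> deconcat (cinj q H w) = 0.
Proof.
move=> pH; rewrite mklinE /deconcat_fun big1 // => F _; rewrite big1 // => G _.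
rewrite cinj_at0 ?linear0 //.
by apply: contra pH => /eqP->; exact: concat_passes.
Qed.

Lemma free_muE (F : compn (sub S)) (G : compn (sub T)) v w :
  mu mtq d (tens (cinj q F v) (cinj q G w)) =
  cinj q (compn_concat d F G)
    (ccat q _ _ (tens (cmap q (@incl_inj _ _ _ (decomp_subl d)) F v)
                      (cmap q (@incl_inj _ _ _ (decomp_subr d)) G w))).
Proof.
rewrite /= tliftE /free_mu_fun (bigD1 F) //= (bigD1 G) //= !cinj_at.
rewrite !big1 ?addr0 // => [F' FF'|G' GG'].
  by rewrite big1 // => G' _; rewrite cinj_at0 1?eq_sym // linear0 tens0l !linear0.
by rewrite (cinj_at0 (F := G)) 1?eq_sym // linear0 tens0r !linear0.
Qed.

End Deconcatenation.

Definition free_comonoid : comonoid_ops tq :=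
  @ComonoidOps K tq (fun X I S T d => deconcat d)
    (dproj (fun F : compn void => cten q F) (Compn nil_compn)).
Local Notation ctq := free_comonoid.

(** Reduces identities between the operators [resplit] to statements about which
    compositions pass through a subset. *)
Lemma free_resplitE (X : finType) (I S T : {set X}) (d : decomp I S T)
    (H : compn (sub I)) w :
  resplit mtq ctq d (cinj q H w) = if passes (trace_in I S) H then cinj q H w else 0.
Proof.
rewrite /resplit; case: ifP => [/(passes_concat d)[F [G eH]]|/negbT pH]; last first.
  by rewrite /= deconcat0 // linear0.
subst H; rewrite [comu _ _ _]deconcatE.
rewrite -[in RHS](ccatVK w); move: (ccatV q _ _ w) => t; tind t => u v.
by rewrite tmapE [LHS]free_muE !cmapVK.
Qed.

Lemma free_resplit_coef (X : finType) (I S T : {set X}) (d : decomp I S T)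
    (H : compn (sub I)) (x : free_obj q (sub I)) :
  (resplit mtq ctq d x : free_obj q (sub I)) H = if passes (trace_in I S) H then x H else 0.
Proof.
elim/free_ind: x => [|x y hx hy|F v].
- by rewrite resplit0 ffunE if_same.
- by rewrite resplitD !ffunE hx hy; case: ifP => // _; rewrite addr0.
rewrite free_resplitE; have [eFH|FH] := eqVneq F H; first subst H.
  by case: ifP => // _; rewrite ffunE.
by rewrite cinj_at0 // if_same; case: ifP => _; rewrite ?cinj_at0 // ffunE.
Qed.

Lemma trace_in_incl (X : finType) (R I J : {set X}) (sIJ : I \subset J) :
  incl sIJ @^-1: trace_in J R = trace_in I R.
Proof. by apply/setP => x; rewrite !inE. Qed.

(** In each case the two sides are projections onto the compositions that pass
    through given subsets, and it remains to compare these passing conditions. *)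
Lemma free_nested_split : nested_split mtq ctq.
Proof.
split.
- move=> X Y I S T I' S' T' d d' f g h rg rh x.
  elim/free_ind: x => [|x y hx hy|F v]; first by rewrite !(linear0, resplit0).
    by rewrite !(resplitD, linearD) hx hy.
  rewrite free_resplitE [sp_map _ _ _]fun_if linear0 /= free_mapE free_resplitE imset_passes.
  congr (if passes _ _ then _ else _); apply/setP => x; rewrite !inE.
  by rewrite (restricts_mem d d' rg rh).
- move=> X I S T d x; tind x => x y.
  elim/free_ind: x => [|x1 x2 hx hy|F v]; first by rewrite tens0l !linear0.
    by rewrite tensDl !linearD hx hy.
  elim/free_ind: y => [|x1 x2 hx hy|G w]; first by rewrite tens0r !linear0.
    by rewrite tensDr !linearD hx hy.
  by rewrite free_muE [LHS]deconcatE ccatK tmapE /= !cmapK.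
- move=> X I R S T RS ST dRS dRS_T dST dR_ST x y.
  elim/free_ind: x => [|x1 x2 hx hy|F v]; first by rewrite !(tens0l, linear0, resplit0).
    by rewrite !(tensDl, resplitD, linearD) hx hy.
  elim/free_ind: y => [|x1 x2 hx hy|G w]; first by rewrite !(tens0r, linear0, resplit0).
    by rewrite !(tensDr, resplitD, linearD) hx hy.
  rewrite free_muE free_resplitE passes_catl; last first.
    apply: inclT_away; rewrite disjoint_sym; have /decompP[_] := dRS_T.
    by apply: disjointWl; exact: decomp_subl dRS.
  rewrite imset_passes trace_in_incl free_resplitE; case: ifP => _; first by rewrite free_muE.
  by rewrite tens0l linear0.
- move=> X I R S T RS ST dRS dRS_T dST dR_ST x y.
  elim/free_ind: x => [|x1 x2 hx hy|F v]; first by rewrite !(tens0l, linear0, resplit0).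
    by rewrite !(tensDl, resplitD, linearD) hx hy.
  elim/free_ind: y => [|x1 x2 hx hy|G w]; first by rewrite !(tens0r, linear0, resplit0).
    by rewrite !(tensDr, resplitD, linearD) hx hy.
  rewrite free_muE free_resplitE passes_catr; last first.
    apply: belowS (inclS_below dR_ST F); apply/subsetP => z; rewrite !inE.
    exact/subsetP/(decomp_subl dRS).
  rewrite imset_passes trace_in_incl free_resplitE.
  have -> : trace_in ST RS = trace_in ST S.
    apply/setP => z; rewrite !inE; have [-> _] := decomp_mem dRS (val z).
    have [_] := decomp_mem dR_ST (val z); rewrite (valP z) andbT.
    by move=> /negbTE ->.
  case: ifP => _; first by rewrite free_muE.
  by rewrite tens0r linear0.
- move=> X I R S T RS ST dRS dRS_T dST dR_ST x.
  elim/free_ind: x => [|x1 x2 hx hy|F v]; first by rewrite !resplit0.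
    by rewrite !resplitD hx hy.
  rewrite !free_resplitE; case: ifP => h1; case: ifP => h2;
    by rewrite ?resplit0 ?free_resplitE ?h1 ?h2.
Qed.

(** If [F . G] passes through [S'], then either all of [F] lies inside [S'] or all
    of [G] lies outside, that is, [S] and [S'] are comparable. *)
Lemma free_crossing_free : crossing_free mtq ctq.
Proof.
move=> X I S T S' T' d d' x nS nS'; elim/tensor_ind: x => [x y|x y hx hy]; last first.
  by rewrite linearD resplitD hx hy addr0.
elim/free_ind: x => [|x1 x2 hx hy|F v]; first by rewrite tens0l linear0 resplit0.
  by rewrite tensDl linearD resplitD hx hy addr0.
elim/free_ind: y => [|x1 x2 hx hy|G w]; first by rewrite tens0r linear0 resplit0.
  by rewrite tensDr linearD resplitD hx hy addr0.
rewrite free_muE free_resplitE; case: ifP => // /passes_cat_inv[bF|].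
  case/negP: nS; apply/subsetP => z zS; pose y : sub S := exist (fun z => z \in S) z zS.
  have [C CF yC] := compn_mem F y.
  have := allP bF _ (map_f (fun C : {set sub S} => incl (decomp_subl d) @: C) CF).
  by move=> /subsetP/(_ (incl (decomp_subl d) y)); rewrite imset_f // inE => /(_ isT).
rewrite imset_away trace_in_incl => aG.
case/negP: nS'; apply/subsetP => z zS'; have zI := subsetP (decomp_subl d') z zS'.
have [+ _] := decomp_mem d z; rewrite zI; case: (boolP (z \in S)) => //= _ /esym zT.
pose y : sub T := exist (fun z => z \in T) z zT.
have [C CG yC] := compn_mem G y.
by have := disjointFr (allP aG _ CG) yC; rewrite inE /= zS'.
Qed.

(** A composition with at least two blocks passes through its first block, which
    is proper, so a primitive element has no component there. *)
Lemma free_prim (X : finType) (I : {set X}) (x : free_obj q (sub I)) :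
  I != set0 -> proper_prim mtq ctq x ->
  forall H : compn (sub I), cseq H != [:: setT] -> x H = 0.
Proof.
move=> I0 px H nH.
have [z0 z0I] := set0Pn _ I0.
suff [S [T [d [S0 T0 pS]]]] : exists S T, exists d : decomp I S T,
    [/\ S != set0, T != set0 & passes (trace_in I S) H].
  by have := free_resplit_coef d H x; rewrite pS px // ffunE.
case: H nH {x px} => -[|C [|D H]] /= cH nH.
- by have [C] := compn_mem (Compn cH) (exist (fun z => z \in I) z0 z0I).
- by case/and3P: cH nH => _ _; rewrite big_seq1 => /eqP -> /eqP.
have /and3P[h0 /andP[/andP[CD aH] _] _] := cH.
pose S := [set val y | y in C].
have trS : trace_in I S = C.
  by apply/setP => y; rewrite inE /S mem_imset //; exact: val_inj.
exists S, (I :\: S).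
have sS : S \subset I by apply/subsetP => _ /imsetP[y _ ->]; exact: valP.
have d : decomp I S (I :\: S).
  rewrite /decomp setIDA setIC -setIDA setDv setI0 eqxx andbT eq_sym; apply/eqP.
  by apply/setP => z; rewrite !inE; case: (boolP (z \in S)) => // /(subsetP sS) ->.
exists d; split.
- by rewrite imset_eq0; apply: contra h0 => /eqP ->; exact: mem_head.
- have [y yD] : exists y, y \in D.
    by apply/set0Pn; apply: contra h0 => /eqP ->; rewrite !inE eqxx orbT.
  apply/set0Pn; exists (val y); rewrite inE (valP y) andbT.
  rewrite mem_imset; last exact: val_inj.
  by rewrite (disjointFl CD yD).
rewrite trS /= subxx; apply: (@passes_away _ C (D :: H)).
by rewrite /away /= disjoint_sym CD; apply: sub_all aH => E; rewrite disjoint_sym.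
Qed.

End FreeComonoid.

(** * The universal property of the free monoid *)

Section Covers.
Variable A : finType.

(** The blocks of [F] are disjoint with union [U], in a form that follows the
    recursion of [block_mul]. *)
Fixpoint covers (F : seq {set A}) (U : {set A}) : bool :=
  if F is C :: F' then (C \subset U) && covers F' (U :\: C) else U == set0.

Lemma covers_compn (F : compn A) : covers F setT.
Proof.
case: F => F /= /and3P[_ + /eqP <-]; elim: F => [|C F IH] /=.
  by rewrite big_nil.
rewrite big_cons => /andP[/allP dC /IH]; rewrite subsetUl setDUl setDv set0U /=.
suff /setDidPl -> : [disjoint \bigcup_(D <- F) D & C] by [].
rewrite disjoint_sym bigcup_seq; apply: bigcup_disjoint => D DF; exact: dC.
Qed.

End Covers.

Lemma imset_setD (A B : finType) (i : A -> B) (hi : injective i) (U C : {set A}) :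
  i @: (U :\: C) = i @: U :\: i @: C.
Proof.
apply/setP => y; apply/imsetP/setDP => [[x + ->]|[/imsetP[x xU ->]]].
  by rewrite inE !mem_imset // => /andP[].
by rewrite mem_imset // => xC; exists x; rewrite // inE xC.
Qed.

Lemma decomp_setD (A : finType) (C U : {set A}) : C \subset U -> decomp U C (U :\: C).
Proof.
move=> /subsetP CU; apply/andP; split; apply/eqP/setP => z; rewrite !inE.
  by case: (boolP (z \in C)) => // /CU.
by case: (z \in C).
Qed.

Lemma covers_imset (A B : finType) (i : A -> B) (hi : injective i) F U :
  covers F U -> covers [seq i @: C | C : {set A} <- F] (i @: U).
Proof.
elim: F U => [|C F IH] U /=; first by move=> /eqP ->; rewrite imset0.
by move=> /andP[CU /IH]; rewrite imsetS //= imset_setD.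
Qed.

Lemma decomp_dec (A : finType) (U C V : {set A}) :
  {decomp U C V} + {~~ decomp U C V}.
Proof. by case: (boolP (decomp U C V)); [left|right]. Qed.

Section Universal.
Variables (K : fieldType) (q b : species K) (m : monoid_ops b) (j : sp_morph q b).
Hypothesis M : is_monoid m.

(** The iterated product of the blocks of [F], with target [U] fixed in advance and
    not computed as a union.  The value is meaningful when [F] covers [U], and is
    zero where the recursion gets stuck. *)
Fixpoint block_mul (A : finType) (F : seq {set A}) (U : {set A}) :
    {linear cten q F -> b (sub U)} :=
  match F return {linear cten q F -> b (sub U)} with
  | [::] => if @eqP _ set0 U is ReflectT e
            then sp_map b (eqb_sub e) \o iota0 m A else \0
  | C :: F' => if decomp_dec U C (U :\: C) is left d
               then mu m d \o tmap (j _) (block_mul F' (U :\: C)) else \0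
  end.

Lemma block_mul_nil (A : finType) (U : {set A}) (e : set0 = U) a :
  block_mul [::] U a = sp_map b (eqb_sub e) (iota0 m A a).
Proof.
rewrite /=; case: eqP => [e'|//]; rewrite /=.
by have -> : e' = e by exact: eq_irrelevance.
Qed.

Lemma block_mul_cons (A : finType) (C U V : {set A}) F (d : decomp U C V) v w :
  block_mul (C :: F) U (tens v w) = mu m d (tens (j _ v) (block_mul F V w)).
Proof.
have eV : V = U :\: C.
  by apply/setP => z; rewrite !inE; have := decomp_mem d z; do ?(case: (z \in _) => /=); move=> [? ?].
subst V; rewrite /=; case: decomp_dec => [d'|]; last by rewrite d.
by rewrite [LHS]/= tmapE; have -> : d' = d by exact: bool_irrelevance.
Qed.

(** Stated for any bijection [g] that agrees with [i] on points, since the set [U']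
    need not be [i @: U] syntactically. *)
Lemma block_mul_cmap (A B : finType) (i : A -> B) (hi : injective i) (F : seq {set A})
    (U : {set A}) (U' : {set B}) (g : bij (sub U) (sub U')) t :
  covers F U -> (forall x, val (g x) = i (val x)) ->
  block_mul [seq i @: C | C : {set A} <- F] U' (cmap q hi F t) = sp_map b g (block_mul F U t).
Proof.
have imU (V : {set A}) (V' : {set B}) (k : bij (sub V) (sub V')) :
    (forall x, val (k x) = i (val x)) -> V' = i @: V.
  move=> hk; have [k' [_ kK]] := bij_inv_ex k; apply/setP => y.
  apply/idP/imsetP => [yV|[x xV ->]].
    pose z : sub V' := exist (fun y => y \in V') y yV.
    by exists (val (k' z)); [exact: (valP (k' z))|rewrite -hk kK].
  by rewrite -[x]/(val (exist (fun y => y \in V) x xV : sub V)) -hk (valP (k _)).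
elim: F U U' g t => [|C F IH] U U' g t /= cU hg.
  have e : set0 = U by apply/esym/eqP.
  have e' : set0 = U' by rewrite (imU _ _ _ hg) -e imset0.
  rewrite (block_mul_nil e) (block_mul_nil e') /= -!sp_comp; congr (sp_map b _ _).
  by apply: bij_eq => -[].
move: cU => /andP[CU cF]; have d := decomp_setD CU.
have d' : decomp U' (i @: C) (i @: (U :\: C)).
  by rewrite (imU _ _ _ hg) (imset_setD hi); apply: decomp_setD; exact: imsetS.
tind t => v w; rewrite tmapE (block_mul_cons d) (block_mul_cons d').
rewrite (IH _ _ (imb hi (U :\: C))) // (mu_natural M d d' (g := imb hi C)
  (h := imb hi (U :\: C))).
- by rewrite tmapE sp_natural.
- by move=> x y e; exact: etrans (hg x) (congr1 i e).
- by move=> x y e; exact: etrans (hg x) (congr1 i e).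
Qed.

Lemma block_mul_ccat (A : finType) (F G : seq {set A}) (U V W : {set A})
    (d : decomp U V W) v w :
  covers F V -> block_mul (F ++ G) U (ccat q F G (tens v w)) =
  mu m d (tens (block_mul F V v) (block_mul G W w)).
Proof.
elim: F U V d v => [|C F IH] U V d v /= cV.
  have e : set0 = V by apply/esym/eqP.
  subst V; have eW : W = U by have /decompP[-> _] := d; rewrite set0U.
  subst W; rewrite tliftE linZ.
  rewrite -/(block_mul [::] set0) (block_mul_nil erefl) [sp_map b _ (iota0 _ _ _)]sp_id.
  have -> : d = decomp0l U by exact: bool_irrelevance.
  have va : iota0 m A v = v *: iota0 m A 1.
    by rewrite -linZ; congr (iota0 m A _); exact/esym/mulr1.
  have := mu_unitl M (block_mul G U w); rewrite tunitlE tmapE => uw.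
  by rewrite va tensZl linZ uw.
move: cV => /andP[CV cF]; tind v => v1 v2.
rewrite tassocE tmapE.
have dV := decomp_setD CV.
have dU : decomp U C ((V :\: C) :|: W).
  apply/andP; split; apply/eqP/setP => z; rewrite !inE;
  move: (decomp_mem d z) (subsetP CV z);
  do ?(case: (z \in _) => /=); by move=> [? ?] // /(_ isT).
have d2 : decomp ((V :\: C) :|: W) (V :\: C) W.
  apply/andP; split; rewrite ?eqxx //; apply/eqP/setP => z; rewrite !inE.
  move: (decomp_mem d z); do ?(case: (z \in _) => /=); by move=> [? ?].
rewrite (block_mul_cons dU) (block_mul_cons dV) (IH _ _ d2) //.
have := mu_assoc M dV d d2 dU (tens (tens (j _ v1) (block_mul F _ v2)) (block_mul G W w)).
by rewrite tassocE !tmapE => ->.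
Qed.

Definition free_lift_fun (A : finType) : {linear free_obj q A -> b A} :=
  dlift (fun F : compn A => sp_map b (setTbV A) \o block_mul F setT).

Lemma free_lift_cinj (A : finType) (F : compn A) v :
  free_lift_fun A (cinj q F v) = sp_map b (setTbV A) (block_mul F setT v).
Proof. exact: dliftE. Qed.

Fact free_lift_natural (A B : finType) (f : bij A B) x :
  free_lift_fun B (sp_map (free_species q) f x) = sp_map b f (free_lift_fun A x).
Proof.
elim/free_ind: x => [|x y hx hy|F v]; first by rewrite !linear0.
  by rewrite !linearD hx hy.
rewrite [sp_map _ _ _]free_mapE !free_lift_cinj.
rewrite (@block_mul_cmap _ _ _ _ F _ _ (bcomp (setTb B) (bcomp f (setTbV A)))) ?covers_compn //.
by rewrite -!sp_comp; congr (sp_map b _ _); exact: bij_eq.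
Qed.

Definition free_lift : sp_morph (free_species q) b := SpMorph free_lift_natural.

(** The product of the free monoid is formed inside the type of elements of [I],
    where [S] and [T] appear as images; naturality brings the product back to the
    ambient type. *)
Lemma free_lift_morph : is_monoid_morph (free_monoid q) m free_lift.
Proof.
split=> [X I S T d x|a]; last first.
  have e : set0 = [set: void] by apply/setP => -[].
  transitivity (free_lift_fun void (cinj q (Compn nil_compn) a)); first by [].
  rewrite free_lift_cinj -[block_mul _ _]/(block_mul [::] setT) (block_mul_nil e) /= -!sp_comp -[RHS]sp_id.
  by congr (sp_map b _ _); apply: bij_eq => -[].
tind x => x y.
elim/free_ind: x => [|x1 x2 hx hy|F v]; first by rewrite tens0l !linear0.
  by rewrite tensDl !linearD hx hy.
elim/free_ind: y => [|x1 x2 hx hy|G w]; first by rewrite tens0r !linear0.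
  by rewrite tensDr !linearD hx hy.
rewrite free_muE tmapE [free_lift _ (cinj q F v)]free_lift_cinj [free_lift _ (cinj q G w)]free_lift_cinj.
set iS := incl (decomp_subl d); set iT := incl (decomp_subr d).
pose hS : injective iS := @incl_inj _ _ _ (decomp_subl d).
pose hT : injective iT := @incl_inj _ _ _ (decomp_subr d).
have D : decomp [set: sub I] (iS @: setT) (iT @: setT).
  apply/decompP; rewrite inclU; split=> //; exact: incl_disjoint.
transitivity (sp_map b (setTbV (sub I)) (block_mul ([seq iS @: C | C : {set sub S} <- F] ++
    [seq iT @: C | C : {set sub T} <- G]) setT
    (ccat q _ _ (tens (cmap q hS F v) (cmap q hT G w))))); first exact: (free_lift_cinj (F := compn_concat d F G)).
rewrite (block_mul_ccat D) ?covers_imset ?covers_compn //.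
rewrite (@block_mul_cmap _ _ _ _ F _ _ (imb hS setT)) ?covers_compn //.
rewrite (@block_mul_cmap _ _ _ _ G _ _ (imb hT setT)) ?covers_compn //.
rewrite -[RHS]sp_id -(setTbK (sub I)) sp_comp; congr (sp_map b _ _).
rewrite (mu_natural M d D (g := bcomp (imb hS setT) (setTb (sub S)))
  (h := bcomp (imb hT setT) (setTb (sub T)))).
- rewrite tmapE -!sp_comp; congr (mu m _ (tens _ _)); congr (sp_map b _ _);
  by apply: bij_eq => x; apply: val_inj.
- by move=> x y e; apply: val_inj.
- by move=> x y e; apply: val_inj.
Qed.

Lemma free_lift_single (A : finType) (hA : is_compn [:: [set: A]]) v :
  free_lift A (cinj q (Compn hA) (tens v 1)) = j A (sp_map q (setTbV A) v).
Proof.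
rewrite [LHS]free_lift_cinj (block_mul_cons (decomp0r _)) (block_mul_nil erefl) /= sp_id.
have := mu_unitr M (j _ v); rewrite tunitrE tmapE /= => ->.
by rewrite sp_natural.
Qed.

End Universal.

(** * The species of primitive elements *)

Section Submodule.
Variables (K : fieldType) (V : lmodType K).

(** The closure properties are packed with the predicate so that the instances on
    the subtype can be found from it. *)
Record submodule := Submodule {
  sm_mem : V -> Prop;
  sm_mem0 : sm_mem 0;
  sm_memP : forall a x y, sm_mem x -> sm_mem y -> sm_mem (a *: x + y)
}.

Variable S : submodule.

Definition sm_pred : {pred V} := fun x => `[< sm_mem S x >].

Fact sm_closed : submod_closed sm_pred.
Proof.
split=> [|a x y /asboolP hx /asboolP hy]; apply/asboolP; first exact: sm_mem0.
exact: sm_memP.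
Qed.

HB.instance Definition _ := GRing.isSubmodClosed.Build K V sm_pred sm_closed.

Definition submod := {x : V | x \in sm_pred}.

HB.instance Definition _ := SubChoice.on submod.
HB.instance Definition _ := [SubChoice_isSubLmodule of submod by <:].

Lemma submodP (x : submod) : sm_mem S (val x).
Proof. exact/asboolP/(valP x). Qed.

Definition Submod (x : V) (hx : sm_mem S x) : submod :=
  exist (fun x => x \in sm_pred) x (asboolT hx).

End Submodule.

Section PrimitiveSpecies.
Variables (K : fieldType) (b : species K) (m : monoid_ops b) (c : comonoid_ops b).

(** Quantifying over all the ways to see [A] as a subset makes naturality
    immediate.  The first clause makes the species positive. *)
Definition primitive (A : finType) (x : b A) : Prop :=
  (#|A| = 0%N -> x = 0) /\
  forall (X : finType) (I : {set X}) (f : bij A (sub I)), proper_prim m c (sp_map b f x).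

Fact primitive0 A : @primitive A 0.
Proof. by split=> // X I f S T d _ _; rewrite linear0 resplit0. Qed.

Fact primitiveP A a (x y : b A) : primitive x -> primitive y -> primitive (a *: x + y).
Proof.
move=> [x0 px] [y0 py]; split=> [A0|X I f S T d S0 T0].
  by rewrite x0 // y0 // scaler0 addr0.
by rewrite linearP resplitD resplitZ (px _ _ f) // (py _ _ f) // scaler0 addr0.
Qed.

Definition primitives (A : finType) : submodule (b A) :=
  Submodule (@primitive0 A) (@primitiveP A).

Fact primitive_map (A B : finType) (f : bij A B) x :
  primitive x -> primitive (sp_map b f x).
Proof.
move=> [x0 px]; split=> [B0|X I g].
  by rewrite x0 ?linear0 // (bij_eq_card (bij_funP f)).
by rewrite -sp_comp.
Qed.

Definition prim_map_fun (A B : finType) (f : bij A B) (x : submod (primitives A)) :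
    submod (primitives B) :=
  Submod (S := primitives B) (primitive_map f (submodP x)).

Fact prim_map_linear (A B : finType) (f : bij A B) : linear (prim_map_fun f).
Proof. by move=> a x y; apply: val_inj; rewrite /= !linearP. Qed.

Definition prim_map A B f := mklin (@prim_map_linear A B f).

Lemma val_prim_map A B f x : val (@prim_map A B f x) = sp_map b f (val x).
Proof. by rewrite mklinE. Qed.

Fact prim_id (A : finType) x : prim_map (bid A) x = x.
Proof. by apply: val_inj; rewrite val_prim_map sp_id. Qed.

Fact prim_comp (A B C : finType) (g : bij B C) (f : bij A B) x :
  prim_map (bcomp g f) x = prim_map g (prim_map f x).
Proof. by apply: val_inj; rewrite !val_prim_map sp_comp. Qed.

Definition prim_species : species K :=
  @Species K (fun A => submod (primitives A)) prim_map prim_id prim_comp.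

Definition prim_incl : sp_morph prim_species b :=
  @SpMorph K prim_species b (fun A => val : {linear submod (primitives A) -> b A})
    (fun A B f x => val_prim_map f x).

Lemma prim_species_positive : positive prim_species.
Proof.
by move=> x; apply: val_inj; have [x0 _] := submodP x; rewrite x0 ?card_void // linear0.
Qed.

Hypothesis G : nested_split m c.

(** A decomposition of another copy of [I] is pulled back to [I] along the
    bijection. *)
Lemma primitive_prim (X : finType) (I : {set X}) (x : b (sub I)) :
  I != set0 -> proper_prim m c x -> primitive x.
Proof.
move=> I0 px; split=> [/eqP|Y J f S T d S0 T0].
  by rewrite card_sub_eq0 (negbTE I0).
have [g [fK gK]] := bij_inv_ex f.
have [d' [g1 [g2 [r1 r2]]]] := transport_decomp g d.
have ne (U V : {set _}) (k : bij (sub U) (sub V)) : U != set0 -> V != set0.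
  by rewrite -!card_sub_eq0 (bij_eq_card (bij_funP k)).
have e : sp_map b g (resplit m c d (sp_map b f x)) = 0.
  rewrite (resplit_natural G d d' r1 r2) -sp_comp.
  rewrite (_ : bcomp g f = bid _) ?sp_id; last exact: bij_eq.
  by apply: px; [exact: ne g1 S0|exact: ne g2 T0].
by rewrite -[LHS](sp_mapK g) e linear0.
Qed.

End PrimitiveSpecies.

(** * The freeness criterion *)

Section Freeness.
Variables (K : fieldType) (b : species K) (m : monoid_ops b) (c : comonoid_ops b).
Hypotheses (M : is_monoid m) (G : nested_split m c) (Z : crossing_free m c).
Hypothesis iota_bij : bijective (iota m).

Lemma free_iota_bij (q : species K) : bijective (free_iota q).
Proof.
have compn_void (F : compn void) : F = Compn nil_compn.
  apply: val_inj => /=; case: F => -[|C F] //= /and3P[+ _ _].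
  by rewrite inE (_ : set0 == C) //; apply/eqP/setP => -[].
apply: bij_of_lin => [a a0|x].
  have a0' : cinj q (Compn nil_compn) (a : cten q (Compn nil_compn)) = 0 by exact: a0.
  have := cinj_at (q := q) (F := Compn nil_compn) a.
  by rewrite a0' ffunE => /esym.
exists (x (Compn nil_compn)); rewrite [RHS](cinj_sum x).
rewrite (bigD1 (Compn nil_compn)) //= big1 ?addr0 // => F.
by rewrite (compn_void F) eqxx.
Qed.

Lemma tens1_surj (V : lmodType K) (t : tensor V K^o) : exists v, t = tens v 1.
Proof.
elim/tensor_ind: t => [v a|x y [v ->] [w ->]]; last by exists (v + w); rewrite tensDl.
by exists (a *: v); rewrite tensZl -tensZr; congr tens; exact/esym/mulr1.
Qed.

Lemma one_block_compn (X : finType) (I : {set X}) :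
  I != set0 -> is_compn [:: [set: sub I]].
Proof.
move=> I0; apply/and3P; split; rewrite ?big_seq1 //.
by rewrite inE eq_sym -card_sub_eq0 card_sub cardsT card_sub cards_eq0.
Qed.

Let q := prim_species m c.
Let psi := free_lift (prim_incl m c) M.

Lemma free_prim_single (X : finType) (I : {set X}) (x : free_obj q (sub I)) :
  I != set0 -> proper_prim (free_monoid q) (free_comonoid q) x ->
  exists (hI : is_compn [:: [set: sub I]]) v, x = cinj q (Compn hI) (tens v 1).
Proof.
move=> I0 px.
have hI := one_block_compn I0.
have [v ev] := tens1_surj (x (Compn hI)).
exists hI, v; rewrite -ev {1}(cinj_sum x) (bigD1 (Compn hI)) //= big1 ?addr0 // => F FH.
by rewrite (free_prim I0 px) ?linear0.
Qed.

(** The basis is the species of primitive elements, and the isomorphism is the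
    extension of its inclusion to the free monoid. *)
Theorem free_of_nested_split : is_free m.
Proof.
exists q; split; first exact: prim_species_positive.
have Hpsi : is_monoid_morph (free_monoid q) m psi by exact: free_lift_morph.
apply: (monoid_iso_of_bij Hpsi) => A.
apply: (comparison_bij (free_nested_split q) (@free_crossing_free _ q) G Z Hpsi).
- move=> X I x I0 /(free_prim_single I0)[hI [v ->]]; rewrite free_lift_single /=.
  have [_ /(_ _ _ (bid _))] := submodP (sp_map q (setTbV (sub I)) v).
  by rewrite sp_id.
- move=> X I x I0 /(free_prim_single I0)[hI [v ->]]; rewrite free_lift_single /= => e.
  have v0 : sp_map q (setTbV (sub I)) v = 0 by exact: val_inj.
  by rewrite -[v](sp_mapK (setTbV (sub I))) v0 linear0 tens0l linear0.
- move=> X I y I0 py; pose u : q (sub I) := Submod (S := primitives m c _) (primitive_prim G I0 py).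
  have hI := one_block_compn I0.
  exists (cinj q (Compn hI) (tens (sp_map q (setTb (sub I)) u) 1)).
  by rewrite free_lift_single -sp_comp setTbK sp_id.
- move=> X.
  have [g fK gK] := free_iota_bij q; have [g' f'K g'K] := iota_bij.
  have e a : psi void (free_iota q a) = iota m a := morph_iota Hpsi a.
  have kK p : cancel (sp_map p (of_set0b X)) (sp_map p (to_set0b X)).
    move=> x; rewrite -sp_comp (_ : bcomp _ _ = bid _) ?sp_id //.
    by apply: bij_eq => -[y hy]; have := hy; rewrite inE.
  have k'K p : cancel (sp_map p (to_set0b X)) (sp_map p (of_set0b X)).
    by move=> x; rewrite -sp_comp (_ : bcomp _ _ = bid _) ?sp_id //; apply: bij_eq => -[].
  exists (fun y => sp_map (free_species q) (to_set0b X) (free_iota q (g' (sp_map b (of_set0b X) y)))) => x.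
    by rewrite -sp_natural -[sp_map _ (of_set0b X) x]gK e f'K gK kK.
  by rewrite sp_natural e g'K kK.
Qed.

End Freeness.

Lemma iotaE (K : fieldType) (b : species K) (m : monoid_ops b) a : iota m a = (a : K) *: iota m 1.
Proof. by rewrite -linZ; congr (iota m _); exact/esym/mulr1. Qed.

(** On a line, a left inverse is a two-sided inverse. *)
Lemma connected_iota_epsK (K : fieldType) (b : species K) (q : K)
    (m : monoid_ops b) (c : comonoid_ops b) :
  connected b -> is_bimonoid q m c -> forall y, iota m (eps c y) = y.
Proof.
move=> [f [g fK gK]] B y.
have fE a : f a = a *: f 1 by rewrite -linZ; congr (f _); exact/esym/mulr1.
set d : K := g (iota m 1); set e : K := eps c (f 1).
have i1 : iota m 1 = d *: f 1 by rewrite -fE gK.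
have de : d * e = 1 by have := bim_eps_iota B 1; rewrite i1 linZ.
have ey : eps c y = (g y : K) * e by rewrite -{1}[y]gK fE linZ.
by rewrite iotaE i1 ey scalerA -mulrA (mulrC e) de mulr1 -fE gK.
Qed.

Theorem theorem3p2 (K : fieldType) (p q : K)
    (h : species K) (mh : monoid_ops h) (ch : comonoid_ops h)
    (k : species K) (mk : monoid_ops k) (ck : comonoid_ops k) :
  connected h -> is_hopf p mh ch ->
  is_hopf q mk ck -> is_free mk ->
  [/\ connected (hadamard h k),
      is_hopf (p * q) (hadamard_monoid mh mk) (hadamard_comonoid ch ck)
    & is_free (hadamard_monoid mh mk)].
Proof.
move=> conn_h [Bh _] [Bk _] [r [_ [phi [psi [Hphi Hpsi phiK psiK]]]]].
have iK := connected_iota_epsK conn_h Bh.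
(* A free monoid is connected, and connectedness is invariant under isomorphism. *)
have conn_k : connected k.
  exists (psi void \o free_iota r); apply: bij_comp (free_iota_bij r).
  by exists (phi void) => x; rewrite ?psiK ?phiK.
have jK := connected_iota_epsK conn_k Bk.
have Bhk := had_is_bimonoid Bh Bk.
have hkK y : iota (hadamard_monoid mh mk) (eps (hadamard_comonoid ch ck) y) = y.
  elim/tensor_ind: y => [u v|u v hu hv]; last by rewrite !linearD hu hv.
  rewrite had_epsE had_iotaE -[in RHS](iK u) -[in RHS](jK v).
  by rewrite (iotaE mh (eps ch u)) (iotaE mk (eps ck v)) (iotaE mk (_ * _)) tensZl !tensZr scalerA.
have iota_bij : bijective (iota (hadamard_monoid mh mk)).
  by exists (eps (hadamard_comonoid ch ck)) => // a; rewrite (bim_eps_iota Bhk).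
split.
- by exists (iota (hadamard_monoid mh mk)).
- split=> //; exact: antipode_exists (bim_monoid Bhk) (bim_comonoid Bhk) hkK.
(* From here on, the coproduct of k is deconcatenation and not ck. *)
have Gk := transport_nested_split Hphi Hpsi phiK psiK (free_nested_split r).
have Zk := transport_crossing_free Hphi Hpsi (@free_crossing_free _ r).
apply: (free_of_nested_split (bim_monoid Bhk) (had_nested_split (bimonoid_nested_split Bh iK) Gk)) => //.
exact: had_crossing_free.
Qed.
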